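(* (i) There is a canonical functor $\mathfrak{M}^\ddag:\mathbf{G}_{\mathrm{fnt}}^{\mathrm{op}}\times\mathbf{G}\to\mathbf{S}_{\mathrm{c}}$, induced on the opposite categories by the functor $\mathfrak{A}^\ddag:\mathbf{H}\times\mathbf{H}_{\mathrm{fd}}^{\mathrm{op}}\to\mathbf{A}_{\mathrm{c}}$, such that for all quantum group schemes $G_2\in\mathbf{G}_{\mathrm{fnt}}$, $G_1\in\mathbf{G}$ there is a natural bijection between the set of group homomorphisms from $G_2$ to $G_1$ and the set of points of $\mathfrak{M}^\ddag(G_2,G_1)$. (ii) There is a canonical functor $\mathfrak{M}^\ddag:\mathbf{G}^{\mathrm{op}}\times\mathbf{G}_{\mathrm{fd}}\to\mathbf{indS}_{\mathrm{cfd}}$, induced on the opposite categories by the functor $\mathfrak{A}^\ddag:\mathbf{H}_{\mathrm{fg}}\times\mathbf{H}^{\mathrm{op}}\to\mathbf{proA}_{\mathrm{cfg}}$, such that for all quantum group schemes $G_2\in\mathbf{G}$, $G_1\in\mathbf{G}_{\mathrm{fd}}$ there is a natural bijection between the set of group homomorphisms from $G_2$ to $G_1$ and the set of points of $\mathfrak{M}^\ddag(G_2,G_1)$.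
   Context: Fix a field $\mathbb{K}$; algebras and tensor products are over $\mathbb{K}$. Algebras are unital and associative and morphisms preserve units. $\mathbf{A}_{\mathrm{c}}$ is the category of commutative algebras, $\mathbf{A}_{\mathrm{cfg}}$ that of commutative finitely generated algebras. $\mathbf{H}$ is the category of Hopf algebras; $\mathbf{H}_{\mathrm{fd}}$, $\mathbf{H}_{\mathrm{fg}}$ are the full subcategories of finite dimensional ones, respectively of those finitely generated as algebras. For a category $\mathbf{C}$, $\mathbf{proC}$ is the category of pro-objects (inverse systems in $\mathbf{C}$ indexed by directed sets) with $\mathbf{proC}(C,D)=\varprojlim_j\varinjlim_i\mathbf{C}(C_i,D_j)$; objects of $\mathbf{C}$ are pro-objects over a one-element index set. For pro-algebras, $(A\otimes B)_{(i,j)}=A_i\otimes B_j$ with the evident transition maps. A commutative pro-algebra is a pro-object of $\mathbf{A}_{\mathrm{c}}$. Dual notation: $\mathbf{S}_{\mathrm{c}}:=\mathbf{A}_{\mathrm{c}}^{\mathrm{op}}$, $\mathbf{indS}_{\mathrm{cfd}}:=\mathbf{proA}_{\mathrm{cfg}}^{\mathrm{op}}$, $\mathbf{G}:=\mathbf{H}^{\mathrm{op}}$ (quantum group schemes; morphisms are called group homomorphisms), $\mathbf{G}_{\mathrm{fnt}}:=\mathbf{H}_{\mathrm{fd}}^{\mathrm{op}}$, $\mathbf{G}_{\mathrm{fd}}:=\mathbf{H}_{\mathrm{fg}}^{\mathrm{op}}$. $\mathfrak{S}$ denotes the renaming duality functor to the opposite categories. A point of $\mathfrak{S}A$ is an algebra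 morphism $A\to\mathbb{K}$ when $A$ is an algebra, and a pro-morphism $A\to\mathbb{K}$ when $A$ is a pro-algebra. For Hopf algebras $H_1,H_2$ with comultiplications $\Delta_1,\Delta_2$, a (pro-)family of Hopf-algebra morphisms from $H_1$ to $H_2$ is a commutative (pro-)algebra $R$ with a (pro-)algebra morphism $\psi:H_1\to H_2\otimes R$ satisfying $(\Delta_2\otimes\mathrm{id}_R)\psi=(\mathrm{id}_{H_2\otimes H_2}\otimes\mu_R)(\mathrm{id}_{H_2}\otimes F\otimes\mathrm{id}_R)(\psi\otimes\psi)\Delta_1$, where $\mu_R$ is the multiplication of $R$ and $F$ the flip. The functors $\mathfrak{A}^\ddag$ (in (i) with values in $\mathbf{A}_{\mathrm{c}}$, in (ii) with values in $\mathbf{proA}_{\mathrm{cfg}}$) are those that come with natural (pro-)families $\mathfrak{h}^\ddag(H_1,H_2):H_1\to H_2\otimes\mathfrak{A}^\ddag(H_1,H_2)$ of Hopf-algebra morphisms, where naturality means $(\mathrm{id}\otimes\mathfrak{A}^\ddag(g,f))\mathfrak{h}^\ddag(H_1,H_2)=(f\otimes\mathrm{id})\mathfrak{h}^\ddag(H_1',H_2')g$ for $g:H_1\to H_1'$, $f:H_2'\to H_2$, and that are characterized by the universal property: every (pro-)family $\psi:H_1\to H_2\otimes R$ of Hopf-algebra morphisms equals $(\mathrm{id}_{H_2}\otimes\hat\psi)\mathfrak{h}^\ddag(H_1,H_2)$ for a unique (pro-)morphism $\hat\psi:\mathfrak{A}^\ddag(H_1,H_2)\to R$. Thus $\mathfrak{M}^\ddag(\mathfrak{S}H_2,\mathfrak{S}H_1)=\mathfrak{S}\mathfrak{A}^\ddag(H_1,H_2)$.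 *)

(* Defs.v *)
From HB Require Import structures.
From mathcomp Require Import all_boot all_algebra.
From mathcomp Require Import boolp.
Set Implicit Arguments. Unset Strict Implicit. Unset Printing Implicit Defensive.
Import GRing.Theory.
Local Open Scope ring_scope.
Local Open Scope quotient_scope.

Section TensorModule.
Variables (K : fieldType) (U V : lmodType K).

Definition bilin (W : lmodType K) (b : U -> V -> W) : Prop :=
  (forall v, linear (b^~ v)) /\ (forall u, linear (b u)).

Definition tsum (W : lmodType K) (b : U -> V -> W) (s : seq (U * V)) : W :=
  \sum_(p <- s) b p.1 p.2.

(* U (x) V is the type of formal sums of pairs (u, v), two of which are
   identified when every bilinear map out of U x V takes the same value on them.
   [tpure u v] is the elementary tensor; [tlift b] is the linear map induced by a
   bilinear b (tlift_linear, tlift_pure), and it is unique (tens_lin_ext). *)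
Definition tens_rel (s t : seq (U * V)) : bool :=
  `[< forall (W : lmodType K) (b : U -> V -> W), bilin b -> tsum b s = tsum b t >].

Lemma tens_rel_refl : reflexive tens_rel.
Proof. by move=> s; apply/asboolP. Qed.

Lemma tens_rel_sym : symmetric tens_rel.
Proof.
move=> s t; apply/idP/idP => /asboolP H; apply/asboolP => W b Hb;
by rewrite H.
Qed.

Lemma tens_rel_trans : transitive tens_rel.
Proof.
move=> t s r /asboolP H1 /asboolP H2; apply/asboolP => W b Hb.
by rewrite H1 // H2.
Qed.

Definition tens_equiv :=
  EquivRel tens_rel tens_rel_refl tens_rel_sym tens_rel_trans.

Definition tens : Type := {eq_quot tens_equiv}.
HB.instance Definition _ := Choice.copy tens {eq_quot tens_equiv}.

Definition tpure (u : U) (v : V) : tens := \pi_{eq_quot tens_equiv} [:: (u, v)].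

Definition tlift (W : lmodType K) (b : U -> V -> W) (t : tens) : W :=
  tsum b (repr (t : {eq_quot tens_equiv})).

Lemma tlift_pi (W : lmodType K) (b : U -> V -> W) s : bilin b ->
  tlift b (\pi_{eq_quot tens_equiv} s : tens) = tsum b s.
Proof.
move=> Hb; have : tens_rel (repr (\pi_{eq_quot tens_equiv} s)) s.
  by apply/(@eqmodP _ tens_equiv); rewrite reprK.
by move=> /asboolP; apply.
Qed.

Lemma tens_eqP (s t : tens) :
  (forall (W : lmodType K) (b : U -> V -> W), bilin b -> tlift b s = tlift b t) ->
  s = t.
Proof.
move=> H; rewrite -[s](@reprK _ {eq_quot tens_equiv}).
rewrite -[t](@reprK _ {eq_quot tens_equiv}).
by apply/(@eqmodP _ tens_equiv)/asboolP.
Qed.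

Lemma bilin0l (W : lmodType K) (b : U -> V -> W) v : bilin b -> b 0 v = 0.
Proof.
case=> H _; have /= := H v (- 1) 0 0.
by rewrite scaler0 addr0 scaleN1r addNr.
Qed.

Lemma bilinZl (W : lmodType K) (b : U -> V -> W) c u v :
  bilin b -> b (c *: u) v = c *: b u v.
Proof.
move=> Hb; have /= := Hb.1 v c u 0.
by rewrite addr0 bilin0l // addr0.
Qed.

Definition tzero : tens := \pi_{eq_quot tens_equiv} [::].
Definition tadd (s t : tens) : tens :=
  \pi_{eq_quot tens_equiv}
    (repr (s : {eq_quot tens_equiv}) ++ repr (t : {eq_quot tens_equiv})).
Definition tscale (c : K) (t : tens) : tens :=
  \pi_{eq_quot tens_equiv}
    [seq (c *: p.1, p.2) | p <- repr (t : {eq_quot tens_equiv})].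
Definition topp (t : tens) : tens := tscale (- 1) t.

Section Tlift.
Variables (W : lmodType K) (b : U -> V -> W).
Hypothesis Hb : bilin b.

Lemma tlift0 : tlift b tzero = 0.
Proof. by rewrite tlift_pi // /tsum big_nil. Qed.

Lemma tliftD s t : tlift b (tadd s t) = tlift b s + tlift b t.
Proof. by rewrite tlift_pi // /tsum big_cat. Qed.

Lemma tliftZ c t : tlift b (tscale c t) = c *: tlift b t.
Proof.
rewrite tlift_pi // /tsum big_map scaler_sumr.
by apply: eq_bigr => p _ /=; rewrite bilinZl.
Qed.

Lemma tlift_pure u v : tlift b (tpure u v) = b u v.
Proof. by rewrite tlift_pi // /tsum big_seq1. Qed.
End Tlift.

Fact taddA : associative tadd.
Proof. by move=> x y z; apply: tens_eqP => W b Hb; rewrite !tliftD // addrA. Qed.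
Fact taddC : commutative tadd.
Proof. by move=> x y; apply: tens_eqP => W b Hb; rewrite !tliftD // addrC. Qed.
Fact tadd0 : left_id tzero tadd.
Proof. by move=> x; apply: tens_eqP => W b Hb; rewrite tliftD // tlift0 // add0r. Qed.
Fact taddN : left_inverse tzero topp tadd.
Proof.
move=> x; apply: tens_eqP => W b Hb.
by rewrite tliftD // tlift0 // tliftZ // scaleN1r addNr.
Qed.

HB.instance Definition _ := GRing.isZmodule.Build tens taddA taddC tadd0 taddN.

Fact tscaleA c d t : tscale c (tscale d t) = tscale (c * d) t.
Proof. by apply: tens_eqP => W b Hb; rewrite !tliftZ // scalerA. Qed.
Fact tscale1 : left_id 1 tscale.
Proof. by move=> x; apply: tens_eqP => W b Hb; rewrite tliftZ // scale1r. Qed.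
Fact tscaleDr : right_distributive tscale +%R.
Proof.
by move=> c x y; apply: tens_eqP => W b Hb; rewrite !(tliftZ, tliftD) // scalerDr.
Qed.
Fact tscaleDl t : {morph tscale^~ t : c d / c + d >-> c + d}.
Proof.
by move=> c d; apply: tens_eqP => W b Hb; rewrite !(tliftZ, tliftD) // scalerDl.
Qed.

HB.instance Definition _ :=
  GRing.Zmodule_isLmodule.Build K tens tscaleA tscale1 tscaleDr tscaleDl.

Lemma tlift_linear (W : lmodType K) (b : U -> V -> W) : bilin b -> linear (tlift b).
Proof. by move=> Hb c x y; rewrite [LHS]tliftD // tliftZ. Qed.

Lemma tpure_bilin : bilin tpure.
Proof.
split=> [v c x y|u c x y]; apply: tens_eqP => W b Hb;
  rewrite [RHS]tliftD // tliftZ // /= !tlift_pure //.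
- exact: Hb.1.
- exact: Hb.2.
Qed.

Lemma lin0 (M N : lmodType K) (f : M -> N) : linear f -> f 0 = 0.
Proof.
by move=> H; have := H (- 1) 0 0; rewrite scaler0 addr0 scaleN1r addNr.
Qed.

Lemma linD (M N : lmodType K) (f : M -> N) x y : linear f -> f (x + y) = f x + f y.
Proof. by move=> H; have := H 1 x y; rewrite !scale1r. Qed.

Lemma tens_sum (t : tens) :
  t = \sum_(p <- repr (t : {eq_quot tens_equiv})) tpure p.1 p.2.
Proof.
apply: tens_eqP => W b Hb.
rewrite [LHS]/tlift /tsum; elim: (repr _) => [|p s IH].
  by rewrite !big_nil lin0 //; exact: tlift_linear.
by rewrite !big_cons IH linD ?tlift_pure //; exact: tlift_linear.
Qed.

Lemma tens_ind (P : tens -> Prop) :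
  (forall u v, P (tpure u v)) -> P 0 -> (forall s t, P s -> P t -> P (s + t)) ->
  forall t, P t.
Proof.
by move=> Hp H0 HD t; rewrite (tens_sum t); apply: big_ind.
Qed.

Lemma tens_lin_ext (W : lmodType K) (f g : tens -> W) :
  linear f -> linear g -> (forall u v, f (tpure u v) = g (tpure u v)) -> f =1 g.
Proof.
move=> Hf Hg H; elim/tens_ind => [//||s t Es Et]; first by rewrite !lin0.
by rewrite !linD // Es Et.
Qed.

End TensorModule.

Section KAlg.
Variable K : fieldType.
(* Unital associative K-algebras. MathComp's algType is not used because it
   imposes 1 != 0, whereas the zero algebra is an algebra here (it may occur as a
   test algebra or as a component of a pro-algebra). *)
Record kalg := KAlg {
  kcar : lmodType K;
  kone : kcar;
  kmul : kcar -> kcar -> kcar;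
  kmulA : associative kmul;
  kmul1l : left_id kone kmul;
  kmul1r : right_id kone kmul;
  kmul_bilin : bilin kmul }.
Definition ksort (A : kalg) : Type := kcar A.
End KAlg.
Coercion ksort : kalg >-> Sortclass.
HB.instance Definition _ (K : fieldType) (A : kalg K) := GRing.Lmodule.copy (ksort A) (kcar A).
Coercion Defs_ksort__canonical__GRing_Lmodule : kalg >-> GRing.Lmodule.type.

Section KRing.
Variables (K : fieldType) (A : kalg K).
Fact kmulDl : left_distributive (@kmul K A : A -> A -> A) +%R.
Proof. by move=> x y z; have := (kmul_bilin A).1 z 1 x y; rewrite !scale1r. Qed.
Fact kmulDr : right_distributive (@kmul K A : A -> A -> A) +%R.
Proof. by move=> x y z; have := (kmul_bilin A).2 x 1 y z; rewrite !scale1r. Qed.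
HB.instance Definition _ := GRing.Zmodule_isPzRing.Build (ksort A)
  (@kmulA K A) (@kmul1l K A) (@kmul1r K A) kmulDl kmulDr.
Lemma kscaleAl c (x y : A) : c *: (x * y) = (c *: x) * y.
Proof. by have := bilinZl c x y (kmul_bilin A). Qed.
End KRing.

Section KRingTheory.
Variables (K : fieldType) (A : kalg K).
Lemma kscaleAr c (x y : A) : c *: (x * y) = x * (c *: y).
Proof.
have := (kmul_bilin A).2 x c y 0.
by rewrite addr0 (lin0 ((kmul_bilin A).2 x)) addr0 => /esym.
Qed.
Lemma kmulr_bilin : @bilin K A A A (fun x y => x * y).
Proof. exact: kmul_bilin. Qed.
End KRingTheory.

Lemma mul_bilin_regular (K : fieldType) : @bilin K K^o K^o K^o (fun x y => x * y).
Proof.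
split=> [v|u] c x y /=.
- by rewrite mulrDl; congr (_ + _); exact/esym/mulrA.
- by rewrite mulrDr; congr (_ + _); exact: mulrCA.
Qed.

Definition kbase (K : fieldType) : kalg K :=
  @KAlg K K^o (1 : K) _ (@mulrA K) (@mul1r K) (@mulr1 K) (@mul_bilin_regular K).

Section AlgHom.
Variable K : fieldType.
Record algHom (A B : kalg K) := AlgHom {
  ahfun :> A -> B;
  ah_linear : linear ahfun;
  ah_monoid : GRing.monoid_morphism ahfun }.

HB.instance Definition _ (A B : kalg K) (f : algHom A B) :=
  GRing.isLinear.Build K A B *:%R (ahfun f) (ah_linear f).
HB.instance Definition _ (A B : kalg K) (f : algHom A B) :=
  GRing.isMonoidMorphism.Build A B (ahfun f) (ah_monoid f).

Lemma algHom_ext (A B : kalg K) (f g : algHom A B) : f =1 g -> f = g.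
Proof.
case: f g => f a b [g a' b'] /= /funext e; subst g.
by rewrite (Prop_irrelevance a a'); case: b b' => b1 b2 [b1' b2']; congr AlgHom;
  rewrite (Prop_irrelevance b1 b1') (Prop_irrelevance b2 b2').
Qed.

Lemma id_monoid (A : kalg K) : @GRing.monoid_morphism A A id.
Proof. by split. Qed.

Definition ah_id (A : kalg K) : algHom A A :=
  @AlgHom A A id (fun _ _ _ => erefl) (id_monoid A).

Section Comp.
Variables (A B C : kalg K) (g : algHom B C) (f : algHom A B).
Lemma comp_linear : linear (g \o f).
Proof. by move=> c x y /=; rewrite !linearP. Qed.

Lemma comp_monoid : GRing.monoid_morphism (g \o f).
Proof. by split=> [|x y] /=; rewrite ?rmorph1 ?rmorphM. Qed.

Definition ah_comp : algHom A C := AlgHom comp_linear comp_monoid.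
End Comp.
End AlgHom.

Section TensorAlgebra.
Variable K : fieldType.

Section Lift.
Variables (U V : lmodType K).
Lemma tlift_lin_fun (W : lmodType K) (b b1 b2 : U -> V -> W) c :
  (forall u v, b u v = c *: b1 u v + b2 u v) ->
  forall t, tlift b t = c *: tlift b1 t + tlift b2 t.
Proof.
move=> H t; rewrite /tlift /tsum scaler_sumr -big_split /=.
by apply: eq_bigr => p _.
Qed.

Definition tmap (U' V' : lmodType K) (f : U -> U') (g : V -> V') : tens U V -> tens U' V' :=
  tlift (fun u v => tpure (f u) (g v)).

Lemma tmap_bilin (U' V' : lmodType K) (f : U -> U') (g : V -> V') :
  linear f -> linear g -> bilin (fun u v => tpure (f u) (g v)).
Proof.
move=> Hf Hg; split=> [v|u] c x y /=.
- by rewrite Hf; exact: (tpure_bilin U' V').1.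
- by rewrite Hg; exact: (tpure_bilin U' V').2.
Qed.
End Lift.

Section Prod.
Variables (A B : kalg K).

Definition tmul_in (a : A) (b : B) : tens A B -> tens A B :=
  tlift (fun a' b' => tpure (a * a') (b * b')).

Definition tmul (s t : tens A B) : tens A B := tlift (fun a b => tmul_in a b t) s.

Lemma tmul_in_bilin a b : bilin (fun (a' : A) (b' : B) => tpure (a * a') (b * b')).
Proof. by apply: tmap_bilin => c x y; rewrite mulrDr kscaleAr. Qed.

Lemma tmul_bilin0 t : bilin (fun a b => tmul_in a b t).
Proof.
split=> [v|u] c x y /=; apply: tlift_lin_fun => a b.
- by rewrite mulrDl -kscaleAl; exact: (tpure_bilin A B).1.
- by rewrite mulrDl -kscaleAl; exact: (tpure_bilin A B).2.
Qed.

Lemma tmul_bilin : @bilin K (tens A B) (tens A B) (tens A B) tmul.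
Proof.
split=> [t|s] c x y; first exact: tlift_linear (tmul_bilin0 t) c x y.
by apply: tlift_lin_fun => a b; exact: tlift_linear (tmul_in_bilin a b) c x y.
Qed.

Lemma tmul_pure a b a' b' :
  tmul (tpure a b) (tpure a' b') = tpure (a * a') (b * b').
Proof.
rewrite /tmul tlift_pure; last exact: tmul_bilin0.
by rewrite /tmul_in tlift_pure //; exact: tmul_in_bilin.
Qed.

Fact tmulA : associative tmul.
Proof.
have [l r] := tmul_bilin.
move=> x y z; elim/tens_ind: x => [a b||x x' Ex Ex'].
- elim/tens_ind: y => [a' b'||y y' Ey Ey'].
  + elim/tens_ind: z => [a'' b''||z z' Ez Ez'].
    * by rewrite !tmul_pure !mulrA.
    * by rewrite !(lin0 (r _)).
    * by rewrite !(linD _ _ (r _)) Ez Ez'.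
  + by rewrite (lin0 (l _)) (lin0 (r _)) (lin0 (l _)).
  + by rewrite (linD _ _ (l _)) !(linD _ _ (r _)) (linD _ _ (l _)) Ey Ey'.
- by rewrite !(lin0 (l _)).
- by rewrite !(linD _ _ (l _)) Ex Ex'.
Qed.

Fact tmul1l : left_id (tpure (1 : A) (1 : B)) tmul.
Proof.
have [l r] := tmul_bilin.
move=> x; elim/tens_ind: x => [a b||x x' Ex Ex'].
- by rewrite tmul_pure !mul1r.
- exact: lin0.
- by rewrite (linD _ _ (r _)) Ex Ex'.
Qed.

Fact tmul1r : right_id (tpure (1 : A) (1 : B)) tmul.
Proof.
have [l r] := tmul_bilin.
move=> x; elim/tens_ind: x => [a b||x x' Ex Ex'].
- by rewrite tmul_pure !mulr1.
- exact: lin0 (l _).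
- by rewrite (linD _ _ (l _)) Ex Ex'.
Qed.

Definition tensA : kalg K := KAlg tmulA tmul1l tmul1r tmul_bilin.

Lemma tensA_mul_pure (a a' : A) (b b' : B) :
  (tpure a b : tensA) * (tpure a' b' : tensA) = tpure (a * a') (b * b') :> tensA.
Proof. exact: tmul_pure. Qed.

Lemma tensA_hom (C : kalg K) (f : tens A B -> C) :
  linear f -> f (tpure (1 : A) (1 : B)) = 1 ->
  (forall (a : A) (b : B) (a' : A) (b' : B),
     f (tpure (a * a') (b * b')) = f (tpure a b) * f (tpure a' b')) ->
  GRing.monoid_morphism (f : tensA -> C).
Proof.
move=> Hf H1 HM; split=> // x y.
have [l r] := tmul_bilin.
elim/tens_ind: x => [a b||x x' Ex Ex'].
- elim/tens_ind: y => [a' b'||y y' Ey Ey'].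
  + by rewrite tensA_mul_pure HM.
  + by rewrite (lin0 Hf) !mulr0 (lin0 Hf).
  + by rewrite mulrDr !(linD _ _ Hf) mulrDr Ey Ey'.
- by rewrite (lin0 Hf) !mul0r (lin0 Hf).
- by rewrite mulrDl !(linD _ _ Hf) mulrDl Ex Ex'.
Qed.
End Prod.

Lemma tmap_linear (U V U' V' : lmodType K) (f : U -> U') (g : V -> V') :
  linear f -> linear g -> linear (tmap f g).
Proof. by move=> Hf Hg; apply/tlift_linear/tmap_bilin. Qed.

Lemma tmap_pure (U V U' V' : lmodType K) (f : U -> U') (g : V -> V') u v :
  linear f -> linear g -> tmap f g (tpure u v) = tpure (f u) (g v).
Proof. by move=> Hf Hg; rewrite /tmap tlift_pure //; exact: tmap_bilin. Qed.

Lemma tmapA_monoid (A B A' B' : kalg K) (f : algHom A A') (g : algHom B B') :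
  @GRing.monoid_morphism (tensA A B) (tensA A' B') (tmap f g).
Proof.
have P := fun a b => tmap_pure a b (ah_linear f) (ah_linear g).
apply: tensA_hom => [||a b a' b'].
- exact: tmap_linear (ah_linear f) (ah_linear g).
- by rewrite P !rmorph1.
- by rewrite !P tensA_mul_pure !rmorphM.
Qed.

Definition tmapA (A B A' B' : kalg K) (f : algHom A A') (g : algHom B B') :
    algHom (tensA A B) (tensA A' B') :=
  @AlgHom K (tensA A B) (tensA A' B') _ (tmap_linear (ah_linear f) (ah_linear g)) (tmapA_monoid f g).

Definition commutativeA (A : kalg K) : Prop := forall x y : A, x * y = y * x.

Definition mu_fun (R : kalg K) : tens R R -> R := @tlift K R R R (fun x y => x * y).

Lemma mu_linear (R : kalg K) : linear (@mu_fun R).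
Proof. exact: tlift_linear (kmulr_bilin R). Qed.

Lemma mu_pure (R : kalg K) (x y : R) : mu_fun (tpure x y) = x * y.
Proof. exact: tlift_pure (kmulr_bilin R) _ _. Qed.

Lemma mu_monoid (R : kalg K) (cR : commutativeA R) :
  @GRing.monoid_morphism (tensA R R) R (@mu_fun R).
Proof.
apply: tensA_hom => [||a b a' b']; first exact: mu_linear.
- by rewrite mu_pure mulr1.
- by rewrite !mu_pure -!mulrA; congr (_ * _); rewrite !mulrA (cR a').
Qed.

Definition mu_hom (R : kalg K) (cR : commutativeA R) : algHom (tensA R R) R :=
  @AlgHom K (tensA R R) R _ (@mu_linear R) (mu_monoid cR).

(* [exchA] is id (x) F (x) id up to reassociation: (a(x)b)(x)(c(x)d) |-> (a(x)c)(x)(b(x)d). *)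
Definition exchA_in (A B C D : kalg K) (a : A) (b : B) : tens C D -> tens (tens A C) (tens B D) :=
  tlift (fun c d => tpure (tpure a c) (tpure b d)).

Lemma exchA_in_bilin (A B C D : kalg K) (a : A) (b : B) :
  bilin (fun (c : C) (d : D) => tpure (tpure a c) (tpure b d)).
Proof. by apply: tmap_bilin; exact: (tpure_bilin _ _).2. Qed.

Lemma exchA_bilin (A B C D : kalg K) t :
  bilin (fun (a : A) (b : B) => @exchA_in A B C D a b t).
Proof.
split=> [v|u] c x y /=; apply: tlift_lin_fun => a b.
- by rewrite (tpure_bilin A C).1; exact: (tpure_bilin _ _).1.
- by rewrite (tpure_bilin B D).1; exact: (tpure_bilin _ _).2.
Qed.

Definition exch_fun (A B C D : kalg K) :
    tens (tens A B) (tens C D) -> tens (tens A C) (tens B D) :=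
  tlift (fun s t => tlift (fun a b => exchA_in a b t) s).

Lemma exch_fun_bilin (A B C D : kalg K) :
  bilin (fun (s : tens A B) (t : tens C D) => tlift (fun a b => exchA_in a b t) s).
Proof.
split=> [t|s] c x y /=; first exact: (tlift_linear (@exchA_bilin A B C D t) c x y).
by apply: tlift_lin_fun => a b; exact: tlift_linear (exchA_in_bilin C D a b) c x y.
Qed.

Lemma exch_pure (A B C D : kalg K) (a : A) (b : B) (c : C) (d : D) :
  exch_fun (tpure (tpure a b) (tpure c d)) = tpure (tpure a c) (tpure b d).
Proof.
rewrite /exch_fun tlift_pure; last exact: exch_fun_bilin.
rewrite tlift_pure; last exact: exchA_bilin.
by rewrite /exchA_in tlift_pure //; exact: exchA_in_bilin.
Qed.

Lemma tens4_ind (A B C D : kalg K) (P : tens (tens A B) (tens C D) -> Prop) :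
  (forall a b c d, P (tpure (tpure a b) (tpure c d))) -> P 0 ->
  (forall s t, P s -> P t -> P (s + t)) -> forall t, P t.
Proof.
have [l r] := tpure_bilin (tens A B) (tens C D).
move=> Hp H0 HD; elim/tens_ind => // s t.
elim/tens_ind: s => [a b||s s' Es Es'].
- elim/tens_ind: t => [//||t t' Et Et'].
  + by rewrite (lin0 (r _)).
  + by rewrite (linD _ _ (r _)); exact: HD.
- by rewrite (lin0 (l _)).
- by rewrite (linD _ _ (l _)); exact: HD.
Qed.

Lemma exch_linear (A B C D : kalg K) : linear (@exch_fun A B C D).
Proof. exact/tlift_linear/exch_fun_bilin. Qed.

Lemma exch_monoid (A B C D : kalg K) :
  @GRing.monoid_morphism (tensA (tensA A B) (tensA C D))
    (tensA (tensA A C) (tensA B D)) (@exch_fun A B C D).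
Proof.
have L := @exch_linear A B C D.
split=> [|x y]; first exact: exch_pure.
elim/tens4_ind: x => [a b c d||x x' Ex Ex'].
- elim/tens4_ind: y => [a' b' c' d'||y y' Ey Ey'].
  + by rewrite !(tensA_mul_pure, exch_pure).
  + by rewrite (lin0 L) !mulr0 (lin0 L).
  + by rewrite mulrDr !(linD _ _ L) mulrDr Ey Ey'.
- by rewrite (lin0 L) !mul0r (lin0 L).
- by rewrite mulrDl !(linD _ _ L) mulrDl Ex Ex'.
Qed.

Definition exchA (A B C D : kalg K) :
    algHom (tensA (tensA A B) (tensA C D)) (tensA (tensA A C) (tensA B D)) :=
  @AlgHom K (tensA (tensA A B) (tensA C D)) (tensA (tensA A C) (tensA B D)) _
    (@exch_linear A B C D) (@exch_monoid A B C D).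
End TensorAlgebra.

Section TensorAssoc.
Variables (K : fieldType) (U V W : lmodType K).

Definition tassoc : tens (tens U V) W -> tens U (tens V W) :=
  tlift (fun s w => tlift (fun u v => tpure u (tpure v w)) s).

Lemma tassoc_in_bilin (w : W) : bilin (fun (u : U) (v : V) => tpure u (tpure v w)).
Proof.
split=> [v|u] c x y /=; first exact: (tpure_bilin _ _).1.
by rewrite (tpure_bilin V W).1; exact: (tpure_bilin _ _).2.
Qed.

Lemma tassoc_bilin :
  bilin (fun (s : tens U V) (w : W) => tlift (fun u v => tpure u (tpure v w)) s).
Proof.
split=> [w|s] c x y /=; first exact: (tlift_linear (tassoc_in_bilin w) c x y).
apply: tlift_lin_fun => u v.
by rewrite (tpure_bilin V W).2; exact: (tpure_bilin _ _).2.
Qed.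

Lemma tassoc_pure u v w : tassoc (tpure (tpure u v) w) = tpure u (tpure v w).
Proof.
rewrite /tassoc tlift_pure; last exact: tassoc_bilin.
by rewrite tlift_pure //; exact: tassoc_in_bilin.
Qed.
End TensorAssoc.

Record category := Category {
  ob :> Type;
  hom : ob -> ob -> Type;
  idc : forall x, hom x x;
  compc : forall x y z, hom y z -> hom x y -> hom x z;
  compcA : forall w x y z (h : hom y z) (g : hom x y) (f : hom w x),
    compc h (compc g f) = compc (compc h g) f;
  comp1c : forall x y (f : hom x y), compc (idc y) f = f;
  compc1 : forall x y (f : hom x y), compc f (idc x) = f }.

Arguments hom {c} x y : rename.
Arguments idc {c} x : rename.
Arguments compc {c x y z} g f : rename.
Arguments compcA {c w x y z} h g f : rename.

Notation "g '\oc' f" := (compc g f) (at level 40, left associativity).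

Definition opC (C : category) : category :=
  @Category C (fun x y => hom y x) (@idc C) (fun x y z g f => f \oc g)
    (fun w x y z h g f => esym (compcA f g h))
    (fun x y f => compc1 f) (fun x y f => comp1c f).

Definition prodC (C D : category) : category.
Proof.
apply: (@Category (C * D) (fun x y => hom x.1 y.1 * hom x.2 y.2)%type
  (fun x => (idc x.1, idc x.2))
  (fun x y z g f => (g.1 \oc f.1, g.2 \oc f.2))).
- by move=> w x y z h g f; rewrite !compcA.
- by move=> x y [f g]; rewrite !comp1c.
- by move=> x y [f g]; rewrite !compc1.
Defined.

Definition fullC (C : category) (P : C -> Prop) : category :=
  @Category {x : C | P x} (fun x y => hom (sval x) (sval y))
    (fun x => idc (sval x)) (fun x y z g f => g \oc f)
    (fun w x y z h g f => compcA h g f)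
    (fun x y f => comp1c f) (fun x y f => compc1 f).

Record functor (C D : category) := Functor {
  fob :> C -> D;
  fmap : forall x y, hom x y -> hom (fob x) (fob y);
  fmap_id : forall x, fmap (idc x) = idc (fob x);
  fmap_comp : forall x y z (g : hom y z) (f : hom x y),
    fmap (g \oc f) = fmap g \oc fmap f }.

Arguments fmap {C D} f0 {x y} f : rename.

Record dirset := Dirset {
  dset :> Type;
  dle : dset -> dset -> Prop;
  dle_refl : forall i, dle i i;
  dle_trans : forall i j k, dle i j -> dle j k -> dle i k;
  d_inh : inhabited dset;
  d_dir : forall i j, exists k, dle i k /\ dle j k }.

Definition unit_dirset : dirset.
Proof. by exists unit (fun _ _ => True) => // i j; exists tt. Defined.

Definition prod_dirset (I J : dirset) : dirset.
Proof.
exists (I * J)%type (fun p q => dle p.1 q.1 /\ dle p.2 q.2).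
- by move=> i; split; apply: dle_refl.
- by move=> i j k [ij ij'] [jk jk']; split; [exact: dle_trans ij jk|exact: dle_trans ij' jk'].
- by case: (d_inh I) (d_inh J) => i [j]; exists; exact: (i, j).
- move=> [i i'] [j j']; have [k [ik jk]] := d_dir i j.
  by have [k' [ik' jk']] := d_dir i' j'; exists (k, k').
Defined.

Definition dle_fst (I J : dirset) (p q : prod_dirset I J) (h : dle p q) :
  dle p.1 q.1 := let: conj a _ := h in a.
Definition dle_snd (I J : dirset) (p q : prod_dirset I J) (h : dle p q) :
  dle p.2 q.2 := let: conj _ b := h in b.

Section Pro.
Variable C : category.

Record invsys := Invsys {
  idx : dirset;
  sys :> idx -> C;
  tr : forall i j : idx, dle i j -> hom (sys j) (sys i);
  tr_id : forall i (p : dle i i), tr p = idc (sys i);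
  tr_comp : forall i j k (p : dle i j) (q : dle j k) (r : dle i k),
    tr p \oc tr q = tr r }.

Section Germ.
Variables (X : invsys) (B : C).

Definition pregerm : Type := {classic {i : idx X & hom (X i) B}}.

(* [germ X B] is the colimit of hom (X i) B over the index set of X. *)
Definition germ_rel (u v : pregerm) : bool :=
  `[< exists (k : idx X) (p : dle (tag u) k) (q : dle (tag v) k),
        tagged u \oc tr p = tagged v \oc tr q >].

Lemma germ_refl : reflexive germ_rel.
Proof. by move=> u; apply/asboolP; exists (tag u), (dle_refl _), (dle_refl _). Qed.

Lemma germ_sym : symmetric germ_rel.
Proof.
by move=> u v; apply/asboolP/asboolP => -[k [p [q e]]]; exists k, q, p.
Qed.

Lemma germ_trans : transitive germ_rel.
Proof.
move=> v u w /asboolP [k [p [q e]]] /asboolP [k' [q' [r e']]].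
have [l [kl kl']] := d_dir k k'.
apply/asboolP; exists l, (dle_trans p kl), (dle_trans r kl').
rewrite -(tr_comp p kl (dle_trans p kl)) -(tr_comp r kl' (dle_trans r kl')).
rewrite !compcA e -e' -!compcA.
by rewrite (tr_comp q kl (dle_trans q kl)) (tr_comp q' kl' (dle_trans q kl)).
Qed.

Definition germ_equiv := EquivRel germ_rel germ_refl germ_sym germ_trans.
Definition germ : Type := {eq_quot germ_equiv}.

Definition germ_of (i : idx X) (u : hom (X i) B) : germ :=
  \pi_{eq_quot germ_equiv}
    (existT (fun i => hom (X i) B) i u : {classic {i : idx X & hom (X i) B}}).
Definition germ_idx (g : germ) : idx X :=
  tag (repr (g : {eq_quot germ_equiv}) : {i : idx X & hom (X i) B}).
Definition germ_hom (g : germ) : hom (X (germ_idx g)) B :=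
  tagged (repr (g : {eq_quot germ_equiv}) : {i : idx X & hom (X i) B}).

Lemma germ_repr g : germ_of (germ_hom g) = g.
Proof.
rewrite -[RHS](@reprK _ {eq_quot germ_equiv}) /germ_of /germ_hom /germ_idx.
by case: (repr _).
Qed.

Lemma germ_eqP i j (u : hom (X i) B) (v : hom (X j) B) :
  germ_of u = germ_of v <->
  exists (k : idx X) (p : dle i k) (q : dle j k), u \oc tr p = v \oc tr q.
Proof.
split=> [/(@eqmodP _ germ_equiv)/asboolP//|H].
exact/(@eqmodP _ germ_equiv)/asboolP.
Qed.

Lemma germ_ind (P : germ -> Prop) :
  (forall i (u : hom (X i) B), P (germ_of u)) -> forall g, P g.
Proof. by move=> H g; rewrite -(germ_repr g). Qed.

Lemma germ_tr i j (p : dle i j) (u : hom (X i) B) : germ_of (u \oc tr p) = germ_of u.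
Proof.
apply/germ_eqP; exists j, (dle_refl j), p.
by rewrite tr_id compc1.
Qed.
End Germ.

Definition germ_post (X : invsys) (B B' : C) (f : hom B B') (g : germ X B) : germ X B' :=
  germ_of (f \oc germ_hom g).

Lemma germ_post_of (X : invsys) (B B' : C) (f : hom B B') i (u : hom (X i) B) :
  germ_post f (germ_of u) = germ_of (f \oc u).
Proof.
have /germ_eqP[k [p [q e]]] := germ_repr (germ_of u).
by apply/germ_eqP; exists k, p, q; rewrite -!compcA e.
Qed.

Lemma germ_post_id (X : invsys) (B : C) (g : germ X B) : germ_post (idc B) g = g.
Proof. by elim/germ_ind: g => i u; rewrite germ_post_of comp1c. Qed.

Lemma germ_post_comp (X : invsys) (B B' B'' : C) (f : hom B B') (f' : hom B' B'') (g : germ X B) :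
  germ_post (f' \oc f) g = germ_post f' (germ_post f g).
Proof. by elim/germ_ind: g => i u; rewrite !germ_post_of compcA. Qed.

(* An element of lim_j colim_i hom (X i) (Y j). *)
Record proHom (X Y : invsys) := ProHom {
  pro_at :> forall j : idx Y, germ X (Y j);
  pro_compat : forall (j k : idx Y) (p : dle j k), germ_post (tr p) (pro_at k) = pro_at j }.

Lemma proHom_ext X Y (f g : proHom X Y) : (forall j, f j = g j) -> f = g.
Proof.
case: f g => f Hf [g Hg] /= e.
have {}e : f = g by apply: functional_extensionality_dep.
by subst g; rewrite (Prop_irrelevance Hf Hg).
Qed.

Section LevelHom.
Variables (X Y : invsys) (phi : idx Y -> idx X) (u : forall j, hom (X (phi j)) (Y j)).
Hypothesis phi_mono : forall j k, dle j k -> dle (phi j) (phi k).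
Hypothesis u_nat : forall j k (p : dle j k), tr p \oc u k = u j \oc tr (phi_mono p).

Definition level_hom : proHom X Y.
Proof.
exists (fun j => germ_of (u j)) => j k p.
by rewrite germ_post_of u_nat germ_tr.
Defined.
End LevelHom.

Definition pro_id (X : invsys) : proHom X X.
Proof.
apply: (@level_hom X X id (fun j => idc (X j)) (fun j k p => p)) => j k p.
by rewrite comp1c compc1.
Defined.

(* Composition of Y_j -> B with f, seen as a map germ Y B -> germ X B. *)
Definition pro_pre (X Y : invsys) (B : C) (f : proHom X Y) (g : germ Y B) : germ X B :=
  germ_post (germ_hom g) (f (germ_idx g)).

Lemma pro_pre_of (X Y : invsys) (B : C) (f : proHom X Y) j (v : hom (Y j) B) :
  pro_pre f (germ_of v) = germ_post v (f j).
Proof.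
have /germ_eqP[k [p [q e]]] := germ_repr (germ_of v).
by rewrite /pro_pre -(pro_compat f p) -(pro_compat f q) -!germ_post_comp e.
Qed.

Definition pro_comp X Y Z (g : proHom Y Z) (f : proHom X Y) : proHom X Z.
Proof.
exists (fun k => pro_pre f (g k)) => j k p.
rewrite -(pro_compat g p); elim/germ_ind: (g k) => i u.
by rewrite germ_post_of !pro_pre_of germ_post_comp.
Defined.

Definition proC : category.
Proof.
apply: (@Category invsys proHom pro_id pro_comp).
- move=> W X Y Z h g f; apply: proHom_ext => j /=.
  elim/germ_ind: (h j) => i u; rewrite (pro_pre_of g) (pro_pre_of (pro_comp g f)) /=.
  elim/germ_ind: (g i) => i' u'.
  by rewrite (germ_post_of u u') !(pro_pre_of f) germ_post_comp.
- move=> X Y f; apply: proHom_ext => j /=.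
  by rewrite pro_pre_of germ_post_id.
- move=> X Y f; apply: proHom_ext => j /=.
  elim/germ_ind: (f j) => i u.
  by rewrite pro_pre_of /= germ_post_of compc1.
Defined.

Definition constP (A : C) : invsys.
Proof.
by apply: (@Invsys unit_dirset (fun=> A) (fun _ _ _ => idc A)) => *; rewrite ?comp1c.
Defined.

Definition constP_hom (A B : C) (f : hom A B) : proHom (constP A) (constP B).
Proof.
by apply: (@level_hom (constP A) (constP B) id (fun=> f)) => // j k p /=;
  rewrite comp1c compc1.
Defined.
End Pro.

Lemma ah_compA (K : fieldType) (A B C D : kalg K) (h : algHom C D) (g : algHom B C)
  (f : algHom A B) : ah_comp h (ah_comp g f) = ah_comp (ah_comp h g) f.
Proof. exact: algHom_ext. Qed.

Lemma ah_comp1l (K : fieldType) (A B : kalg K) (f : algHom A B) :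
  ah_comp (ah_id B) f = f.
Proof. exact: algHom_ext. Qed.

Lemma ah_comp1r (K : fieldType) (A B : kalg K) (f : algHom A B) :
  ah_comp f (ah_id A) = f.
Proof. exact: algHom_ext. Qed.

Definition algC (K : fieldType) : category :=
  @Category (kalg K) (@algHom K) (@ah_id K) (@ah_comp K)
    (@ah_compA K) (@ah_comp1l K) (@ah_comp1r K).

Section TensorFunctor.
Variable K : fieldType.

Lemma algHom_tens_ext (A B C : kalg K) (f g : algHom (tensA A B) C) :
  (forall a b, f (tpure a b) = g (tpure a b)) -> f = g.
Proof.
move=> H; apply/algHom_ext.
exact: (@tens_lin_ext K A B C f g (ah_linear f) (ah_linear g)).
Qed.

Lemma tmapA_pure (A B A' B' : kalg K) (f : algHom A A') (g : algHom B B') a b :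
  tmapA f g (tpure a b) = tpure (f a) (g b).
Proof. exact: tmap_pure (ah_linear f) (ah_linear g). Qed.

Lemma mu_hom_pure (R : kalg K) (cR : commutativeA R) (x y : R) :
  mu_hom cR (tpure x y) = x * y.
Proof. exact: mu_pure. Qed.

Lemma exchA_pure (A B C D : kalg K) (a : A) (b : B) (c : C) (d : D) :
  exchA A B C D (tpure (tpure a b) (tpure c d)) = tpure (tpure a c) (tpure b d).
Proof. exact: exch_pure. Qed.

Lemma tmapA_id (A B : kalg K) : tmapA (ah_id A) (ah_id B) = ah_id (tensA A B).
Proof. by apply: algHom_tens_ext => a b; rewrite tmapA_pure. Qed.

Lemma tmapA_comp (A B A' B' A'' B'' : kalg K) (f : algHom A A') (g : algHom B B')
    (f' : algHom A' A'') (g' : algHom B' B'') :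
  tmapA (ah_comp f' f) (ah_comp g' g) = ah_comp (tmapA f' g') (tmapA f g).
Proof.
apply: algHom_tens_ext => a b.
rewrite [RHS](_ : _ = tmapA f' g' (tmapA f g (tpure a b))) //.
by rewrite !tmapA_pure.
Qed.

Lemma algHom_tens4_ext (A B C D E : kalg K)
    (f g : algHom (tensA (tensA A B) (tensA C D)) E) :
  (forall a b c d, f (tpure (tpure a b) (tpure c d)) = g (tpure (tpure a b) (tpure c d))) ->
  f = g.
Proof.
move=> H; apply/algHom_ext; apply: (@tens4_ind K A B C D) => //.
- exact: etrans (lin0 (ah_linear f)) (esym (lin0 (ah_linear g))).
- move=> s t Es Et; apply: etrans (linD s t (ah_linear f)) _.
  by rewrite Es Et; exact/esym/(linD s t (ah_linear g)).
Qed.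

Definition tensP (X Y : invsys (algC K)) : invsys (algC K).
Proof.
apply: (@Invsys (algC K) (prod_dirset (idx X) (idx Y))
  (fun p => tensA (X p.1) (Y p.2))
  (fun p q pq => tmapA (tr (dle_fst pq)) (tr (dle_snd pq)))).
- by move=> i p; rewrite !tr_id; exact: tmapA_id.
- by move=> i j k p q r; rewrite -(tr_comp (dle_fst p) (dle_fst q) (dle_fst r))
    -(tr_comp (dle_snd p) (dle_snd q) (dle_snd r));
    exact: esym (tmapA_comp _ _ _ _).
Defined.

Definition tens_germ (X Y : invsys (algC K)) (A B : kalg K)
    (f : @germ (algC K) X A) (g : @germ (algC K) Y B) :
    @germ (algC K) (tensP X Y) (tensA A B) :=
  @germ_of (algC K) (tensP X Y) (tensA A B) (germ_idx f, germ_idx g)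
    (tmapA (germ_hom f) (germ_hom g)).

Lemma tens_germ_of (X Y : invsys (algC K)) (A B : kalg K) i j
    (u : @hom (algC K) (X i) A) (v : @hom (algC K) (Y j) B) :
  tens_germ (germ_of u) (germ_of v) =
  @germ_of (algC K) (tensP X Y) (tensA A B) (i, j) (tmapA u v).
Proof.
have /germ_eqP[k [p [q e]]] := germ_repr (germ_of u).
have /germ_eqP[l [p' [q' e']]] := germ_repr (germ_of v).
apply/germ_eqP; exists (k, l), (conj p p'), (conj q q').
rewrite [LHS](_ : _ = tmapA (germ_hom (germ_of u) \oc tr p) (germ_hom (germ_of v) \oc tr p'));
  last exact: esym (tmapA_comp (tr p) (tr p') (germ_hom (germ_of u)) (germ_hom (germ_of v))).
by rewrite e e'; exact: (tmapA_comp (tr q) (tr q') u v).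
Qed.

Definition tmapP (X Y X' Y' : invsys (algC K)) (f : proHom X X') (g : proHom Y Y') :
  proHom (tensP X Y) (tensP X' Y').
Proof.
exists (fun p => tens_germ (f p.1) (g p.2)) => i j p.
rewrite -(pro_compat f (dle_fst p)) -(pro_compat g (dle_snd p)).
elim/germ_ind: (f j.1) => a u; elim/germ_ind: (g j.2) => b v.
rewrite (germ_post_of (tr (dle_fst p)) u) (germ_post_of (tr (dle_snd p)) v) !tens_germ_of.
rewrite germ_post_of; congr germ_of; exact: esym (tmapA_comp _ _ _ _).
Defined.

Definition muP (R : invsys (algC K)) (cR : forall i, commutativeA (R i)) :
  proHom (tensP R R) R.
Proof.
apply: (@level_hom _ (tensP R R) R (fun j => (j, j)) (fun j => mu_hom (cR j))
  (fun j k p => conj p p)) => j k p.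
apply: algHom_tens_ext => a b.
rewrite [LHS](_ : _ = tr p (mu_hom (cR k) (tpure a b))) //.
rewrite [RHS](_ : _ = mu_hom (cR j) (tmapA (tr p) (tr p) (tpure a b))) //.
by rewrite tmapA_pure !mu_hom_pure rmorphM.
Defined.

Definition exchP (X Y Z T : invsys (algC K)) :
  proHom (tensP (tensP X Y) (tensP Z T)) (tensP (tensP X Z) (tensP Y T)).
Proof.
apply: (@level_hom _ (tensP (tensP X Y) (tensP Z T)) (tensP (tensP X Z) (tensP Y T))
  (fun q => ((q.1.1, q.2.1), (q.1.2, q.2.2)))
  (fun q => exchA (X q.1.1) (Y q.2.1) (Z q.1.2) (T q.2.2))
  (fun j k p => conj (conj (dle_fst (dle_fst p)) (dle_fst (dle_snd p))) (conj (dle_snd (dle_fst p)) (dle_snd (dle_snd p))))) => j k p.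
apply: algHom_tens4_ext => a b c d.
rewrite [LHS](_ : _ = tmapA (tmapA (tr (dle_fst (dle_fst p))) (tr (dle_snd (dle_fst p)))) (tmapA (tr (dle_fst (dle_snd p))) (tr (dle_snd (dle_snd p))))
  (exchA _ _ _ _ (tpure (tpure a b) (tpure c d)))) //.
rewrite [RHS](_ : _ = exchA _ _ _ _
  (tmapA (tmapA (tr (dle_fst (dle_fst p))) (tr (dle_fst (dle_snd p)))) (tmapA (tr (dle_snd (dle_fst p))) (tr (dle_snd (dle_snd p))))
     (tpure (tpure a b) (tpure c d)))) //.
by rewrite !(exchA_pure, tmapA_pure).
Defined.

(* The canonical identification of the constant pro-object A (x) B, whose index set
   is unit, with the tensor product of the constant pro-objects A and B, whose index
   set is unit * unit. *)
Definition const_tens (A B : kalg K) :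
  @proHom (algC K) (@constP (algC K) (tensA A B))
    (tensP (@constP (algC K) A) (@constP (algC K) B)).
Proof.
apply: (@level_hom (algC K) (@constP (algC K) (tensA A B))
  (tensP (@constP (algC K) A) (@constP (algC K) B))
  (fun=> tt) (fun=> ah_id (tensA A B)) (fun _ _ _ => I)) => j k p.
exact: etrans (ah_comp1r _) (etrans (tmapA_id _ _) (esym (ah_comp1l _))).
Defined.
End TensorFunctor.

Notation "g '\oA' f" := (ah_comp g f) (at level 40, left associativity).
Notation "g '\oP' f" := (pro_comp g f) (at level 40, left associativity).

Section Hopf.
Variable K : fieldType.

Record hopf := Hopf {
  hopf_alg :> kalg K;
  comul : algHom hopf_alg (tensA hopf_alg hopf_alg);
  counit : algHom hopf_alg (kbase K);
  antipode : hopf_alg -> hopf_alg;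
  antipode_linear : linear antipode;
  comulA : forall x,
    tassoc (tmapA comul (ah_id _) (comul x)) = tmapA (ah_id _) comul (comul x);
  counitl : forall x, tlift (fun a b : hopf_alg => (counit a : K) *: b) (comul x) = x;
  counitr : forall x, tlift (fun a b : hopf_alg => (counit b : K) *: a) (comul x) = x;
  antipodel : forall x,
    mu_fun (tmap antipode id (comul x)) = (counit x : K) *: (1 : hopf_alg);
  antipoder : forall x,
    mu_fun (tmap id antipode (comul x)) = (counit x : K) *: (1 : hopf_alg) }.

(* Compatibility with the antipodes is automatic for bialgebra maps. *)
Record hopfHom (H1 H2 : hopf) := HopfHom {
  hopfHom_alg :> algHom H1 H2;
  hopfHom_comul :
    tmapA hopfHom_alg hopfHom_alg \oA comul H1 = comul H2 \oA hopfHom_alg;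
  hopfHom_counit : counit H2 \oA hopfHom_alg = counit H1 }.

Lemma hopfHom_ext (H1 H2 : hopf) (f g : hopfHom H1 H2) :
  hopfHom_alg f = hopfHom_alg g -> f = g.
Proof.
case: f g => f a b [g a' b'] /= e; subst g.
by rewrite (Prop_irrelevance a a') (Prop_irrelevance b b').
Qed.

Lemma hopf_id_comul (H : hopf) :
  tmapA (ah_id H) (ah_id H) \oA comul H = comul H \oA ah_id H.
Proof. by rewrite tmapA_id ah_comp1l ah_comp1r. Qed.

Definition hopf_id (H : hopf) : hopfHom H H :=
  HopfHom (hopf_id_comul H) (ah_comp1r (counit H)).

Section HopfComp.
Variables (H1 H2 H3 : hopf) (g : hopfHom H2 H3) (f : hopfHom H1 H2).

Lemma hopf_comp_comul :
  tmapA (g \oA f) (g \oA f) \oA comul H1 = comul H3 \oA (g \oA f).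
Proof.
by rewrite tmapA_comp -ah_compA hopfHom_comul !ah_compA hopfHom_comul.
Qed.

Lemma hopf_comp_counit : counit H3 \oA (g \oA f) = counit H1.
Proof. by rewrite ah_compA !hopfHom_counit. Qed.

Definition hopf_comp : hopfHom H1 H3 := HopfHom hopf_comp_comul hopf_comp_counit.
End HopfComp.

Lemma hopf_compA (H1 H2 H3 H4 : hopf) (h : hopfHom H3 H4) (g : hopfHom H2 H3)
  (f : hopfHom H1 H2) : hopf_comp h (hopf_comp g f) = hopf_comp (hopf_comp h g) f.
Proof. exact/hopfHom_ext/ah_compA. Qed.

Lemma hopf_comp1l (H1 H2 : hopf) (f : hopfHom H1 H2) : hopf_comp (hopf_id H2) f = f.
Proof. exact/hopfHom_ext/ah_comp1l. Qed.

Lemma hopf_comp1r (H1 H2 : hopf) (f : hopfHom H1 H2) : hopf_comp f (hopf_id H1) = f.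
Proof. exact/hopfHom_ext/ah_comp1r. Qed.

Definition hopfC : category :=
  @Category hopf hopfHom hopf_id hopf_comp hopf_compA hopf_comp1l hopf_comp1r.

Definition fin_dim (A : kalg K) : Prop := exists n, inhabited (Vector.axiom n A).

Definition fin_gen (A : kalg K) : Prop :=
  exists s : seq A, forall P : A -> Prop,
    P 1 -> (forall x, x \in s -> P x) ->
    (forall (c : K) x y, P x -> P y -> P (c *: x + y)) ->
    (forall x y, P x -> P y -> P (x * y)) ->
    forall x, P x.

Definition hopf_fdC : category := fullC (fun H : hopfC => fin_dim H).
Definition hopf_fgC : category := fullC (fun H : hopfC => fin_gen H).

Definition algcC : category := fullC (fun A : algC K => commutativeA A).
(* Inverse systems in a full subcategory of algebras are the inverse systems of
   algebras whose objects all lie in that subcategory, with the same morphisms. So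
   pro_algcC is pro(A_c) and pro_algcfgC is pro(A_cfg). *)
Definition pro_algcC : category :=
  fullC (fun X : proC (algC K) => forall i, commutativeA (X i)).
Definition pro_algcfgC : category :=
  fullC (fun X : proC (algC K) => forall i, commutativeA (X i) /\ fin_gen (X i)).

Definition family (H1 H2 : hopf) (R : algcC) (psi : algHom H1 (tensA H2 (sval R))) : Prop :=
  tmapA (comul H2) (ah_id (sval R)) \oA psi =
  tmapA (ah_id (tensA H2 H2)) (mu_hom (svalP R))
    \oA exchA H2 (sval R) H2 (sval R) \oA tmapA psi psi \oA comul H1.

Definition const_alg (A : kalg K) : invsys (algC K) := @constP (algC K) A.
Definition const_algHom (A B : kalg K) (f : algHom A B) :
  proHom (const_alg A) (const_alg B) := @constP_hom (algC K) A B f.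

Definition pro_comul (H : hopf) :
    proHom (const_alg H) (tensP (const_alg H) (const_alg H)) :=
  const_tens H H \oP const_algHom (comul H).

Definition pro_family (H1 H2 : hopf) (R : pro_algcC)
    (psi : proHom (const_alg H1) (tensP (const_alg H2) (sval R))) : Prop :=
  tmapP (pro_comul H2) (pro_id (sval R)) \oP psi =
  tmapP (pro_id (tensP (const_alg H2) (const_alg H2))) (muP (svalP R))
    \oP exchP (const_alg H2) (sval R) (const_alg H2) (sval R)
    \oP tmapP psi psi \oP pro_comul H1.

Lemma cfg_comm (X : proC (algC K)) :
  (forall i, commutativeA (X i) /\ fin_gen (X i)) -> forall i, commutativeA (X i).
Proof. by move=> H i; case: (H i). Qed.

Definition cfg_c (X : pro_algcfgC) : pro_algcC :=
  exist _ (sval X) (cfg_comm (svalP X)).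

(* [dagger_fd h]: A is the functor A^ddag on H x H_fd^op with its natural family h;
   [dagger_fg h] is the pro-version on H_fg x H^op. *)
Section DaggerFd.
Variable A : functor (prodC hopfC (opC hopf_fdC)) algcC.
Variable h : forall (H1 : hopfC) (H2 : hopf_fdC),
  algHom H1 (tensA (sval H2) (sval (A (H1, H2)))).

Definition dagger_fd : Prop :=
  [/\ forall H1 H2, family (h H1 H2),
      forall (H1 H1' : hopfC) (H2 H2' : hopf_fdC) (g : hopfHom H1 H1')
             (f : hopfHom (sval H2') (sval H2)),
        tmapA (ah_id (sval H2)) (@fmap _ _ A (H1, H2) (H1', H2') (g, f)) \oA h H1 H2 =
        tmapA f (ah_id (sval (A (H1', H2')))) \oA h H1' H2' \oA g &
      forall (H1 : hopfC) (H2 : hopf_fdC) (R : algcC)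
             (psi : algHom H1 (tensA (sval H2) (sval R))), family psi ->
        exists! psi' : algHom (sval (A (H1, H2))) (sval R),
          psi = tmapA (ah_id (sval H2)) psi' \oA h H1 H2].
End DaggerFd.

Section DaggerFg.
Variable A : functor (prodC hopf_fgC (opC hopfC)) pro_algcfgC.
Variable h : forall (H1 : hopf_fgC) (H2 : hopfC),
  proHom (const_alg (sval H1)) (tensP (const_alg H2) (sval (A (H1, H2)))).

Definition dagger_fg : Prop :=
  [/\ forall H1 H2, pro_family (R := cfg_c (A (H1, H2))) (h H1 H2),
      forall (H1 H1' : hopf_fgC) (H2 H2' : hopfC) (g : hopfHom (sval H1) (sval H1'))
             (f : hopfHom H2' H2),
        tmapP (pro_id (const_alg H2)) (@fmap _ _ A (H1, H2) (H1', H2') (g, f))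
          \oP h H1 H2 =
        tmapP (const_algHom f) (pro_id (sval (A (H1', H2'))))
          \oP h H1' H2' \oP const_algHom g &
      forall (H1 : hopf_fgC) (H2 : hopfC) (R : pro_algcC)
             (psi : proHom (const_alg (sval H1)) (tensP (const_alg H2) (sval R))),
        pro_family psi ->
        exists! psi' : proHom (sval (A (H1, H2))) (sval R),
          psi = tmapP (pro_id (const_alg H2)) psi' \oP h H1 H2].
End DaggerFg.

Definition G_all : category := opC hopfC.
Definition G_fnt : category := opC hopf_fdC.
Definition G_fd : category := opC hopf_fgC.
Definition S_c : category := opC algcC.
Definition indS_cfd : category := opC pro_algcfgC.

Definition points (X : S_c) : Type := algHom (sval X) (kbase K).
Definition points_map (X Y : S_c) (m : hom X Y) (p : points X) : points Y :=
  ah_comp (p : algHom (sval X) (kbase K)) (m : algHom (sval Y) (sval X)).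

Definition ind_points (X : indS_cfd) : Type :=
  proHom (sval X) (const_alg (kbase K)).
Definition ind_points_map (X Y : indS_cfd) (m : hom X Y) (p : ind_points X) :
    ind_points Y :=
  pro_comp (p : proHom (sval X) (const_alg (kbase K)))
           (m : proHom (sval Y) (sval X)).

End Hopf.

(* The functor induced on opposite categories, with the two arguments swapped:
   M(S d, S c) = S A(c, d). *)
Section Opposite.
Variables (C D E : category) (A : functor (prodC C (opC D)) E).
Let P := prodC (opC (opC D)) (opC C).

Definition dual_fmap (p q : P) (f : hom p q) : @hom (opC E) (A (p.2, p.1)) (A (q.2, q.1)) :=
  @fmap _ _ A (q.2, q.1) (p.2, p.1) (f.2, f.1).

Lemma dual_fmap_id (p : P) : dual_fmap (idc p) = @idc (opC E) (A (p.2, p.1)).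
Proof. exact: (fmap_id A (p.2, p.1)). Qed.

Lemma dual_fmap_comp (p q r : P) (g : hom q r) (f : hom p q) :
  dual_fmap (g \oc f) = dual_fmap g \oc dual_fmap f.
Proof.
exact: (@fmap_comp _ _ A (r.2, r.1) (q.2, q.1) (p.2, p.1) (f.2, f.1) (g.2, g.1)).
Qed.

Definition dual_functor : functor P (opC E) :=
  @Functor P (opC E) (fun p => A (p.2, p.1)) dual_fmap dual_fmap_id dual_fmap_comp.
End Opposite.

Section NaturalPoints.
Variable K : fieldType.

Definition natural_points (M : functor (prodC (opC (G_fnt K)) (G_all K)) (S_c K)) : Prop :=
  exists beta : forall (G2 : G_fnt K) (G1 : G_all K),
      @hom (G_all K) (sval G2) G1 -> points (M (G2, G1)),
    (forall G2 G1, bijective (beta G2 G1)) /\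
    forall (G2 G2' : G_fnt K) (G1 G1' : G_all K) (a : hom G2' G2) (b : hom G1 G1')
           (phi : @hom (G_all K) (sval G2) G1),
      beta G2' G1' (@compc (G_all K) _ _ _ b (@compc (G_all K) _ _ _ phi a)) =
      points_map (@fmap _ _ M (G2, G1) (G2', G1') (a, b)) (beta G2 G1 phi).

Definition natural_ind_points (M : functor (prodC (opC (G_all K)) (G_fd K)) (indS_cfd K)) : Prop :=
  exists beta : forall (G2 : G_all K) (G1 : G_fd K),
      @hom (G_all K) G2 (sval G1) -> ind_points (M (G2, G1)),
    (forall G2 G1, bijective (beta G2 G1)) /\
    forall (G2 G2' : G_all K) (G1 G1' : G_fd K) (a : hom G2' G2) (b : hom G1 G1')
           (phi : @hom (G_all K) G2 (sval G1)),
      beta G2' G1' (@compc (G_all K) _ _ _ b (@compc (G_all K) _ _ _ phi a)) =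
      ind_points_map (@fmap _ _ M (G2, G1) (G2', G1') (a, b)) (beta G2 G1 phi).
End NaturalPoints.

(* Main.v *)
From HB Require Import structures.
Require Import Defs.
From mathcomp Require Import all_boot all_algebra.
From mathcomp Require Import boolp classical_sets.

(** Over the ground field, a family [psi : H1 -> H2 (x) K = H2]
is an algebra morphism compatible with the comultiplications. It is automatically
compatible with the counits: the pullback of the counit of [H2] is an idempotent of
the convolution group of characters of [H1], hence equal to the counit of [H1]
([comul_counit]). Families over [K] are thus the Hopf algebra morphisms
([hopf_familyP], [pro_hopf_familyP]), and evaluating the universal property at [K]
gives the bijection of morphisms with points; its naturality is the Yoneda argument
([universal_points]). Functoriality of the representing objects follows in the same
way from their universal property ([universal_functor]). It remains to represent the
families.

Both representing objects come from one construction. Fix generators [a x] of [H1]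
and a finite sequence [e] of vectors of [H2], and consider the families [psi] with
[psi (a x)] in [span e (x) R] for all [x]. Such a [psi] is determined by the
contractions of the [psi (a x)] with linear forms on [H2], so its classifying algebra
should be generated by symbols for these coordinates. It is defined as the quotient
of the polynomial expressions in these symbols by all the identities that hold in
every such family ([presA]). Identities in it, and in its tensor product with any
vector space, can then be checked after specializing to each family; this makes the
generic family an algebra morphism and a family, since each of its specializations is
one ([universal_bounded_family]). If there are finitely many generators [a x], the
classifying algebra is finitely generated, since the linear forms occurring in a
projection onto the span of [e] suffice.

If [H2] is finite-dimensional, a spanning [e] bounds all families, and the
classifying algebra of [e] is the one sought. If [H1] is finitely generated, each
family with values in an algebra is bounded by some [e], but not all of them by the
same one: the classifying algebras for all [e] form an inverse system, and this
pro-algebra represents the pro-families ([span_pro_fam_universal]). *)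

Set Implicit Arguments. Unset Strict Implicit. Unset Printing Implicit Defensive.
Import GRing.Theory.
Local Open Scope ring_scope.
Local Open Scope quotient_scope.

(* Both names also belong to notions on finite functions and on vector spaces. *)
Local Notation family := Defs.family.
Local Notation hom := Defs.hom.

(** * Contractions with linear forms *)

Section Linear.
Variable K : fieldType.

Lemma lin_sum (M N : lmodType K) (f : M -> N) I (r : seq I) (F : I -> M) :
  linear f -> f (\sum_(i <- r) F i) = \sum_(i <- r) f (F i).
Proof.
move=> Hf; elim: r => [|i r IH]; first by rewrite !big_nil (lin0 Hf).
by rewrite !big_cons (linD _ _ Hf) IH.
Qed.

Lemma linZ (M N : lmodType K) (f : M -> N) c x : linear f -> f (c *: x) = c *: f x.
Proof. by move=> Hf; have := Hf c x 0; rewrite (lin0 Hf) !addr0. Qed.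

End Linear.

Section LinearFunctionals.
Variables (K : fieldType) (W : lmodType K).

Definition dual : Type := {phi : W -> K^o | linear phi}.
HB.instance Definition _ := gen_eqMixin dual.

(** Zorn's lemma gives a subspace [M] that is maximal among those avoiding [u].
Every vector is then congruent modulo [M] to a unique multiple of [u], and the
coefficient is the required form. *)
Lemma separating_functional (u : W) : u != 0 -> exists phi : dual, sval phi u = 1.
Proof.
move=> u0; pose P (M : set W) :=
  (forall c x y, M x -> M y -> M (c *: x + y)) /\ ~ M u.
have [|M [[Mlin Mu] Mmax]] := @Zorn_bigcup _ P.
  move=> F FP Ftot; split; last by case=> X /FP[_ Xu] /Xu.
  move=> c x y [X FX Xx] [Y FY Yy].
  have [XY|YX] := Ftot X Y FX FY.
    by exists Y => //; apply: (FP Y FY).1 => //; exact: XY.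
  by exists X => //; apply: (FP X FX).1 => //; exact: YX.
have M0 : M 0.
  apply: contrapT => nM0; have nM x : ~ M x.
    by move=> Mx; apply: nM0; have := Mlin (-1) x x Mx Mx; rewrite scaleN1r addNr.
  apply: (Mmax (set1 0)); first by split=> [x /nM//|/(_ 0 erefl)/nM].
  split=> [c x y -> ->|/= /eqP]; first by rewrite scaler0 addr0.
  by rewrite (negPf u0).
have MZ c x : M x -> M (c *: x) by move=> Mx; have := Mlin c x 0 Mx M0; rewrite addr0.
have MD x y : M x -> M y -> M (x + y).
  by move=> Mx My; have := Mlin 1 x y Mx My; rewrite scale1r.
(* If [v] is outside [M], then by maximality [M] and [v] together span [u], with
   a nonzero coefficient on [v]. *)
have ex v : exists c : K, M (v - c *: u).
  have [Mv|nMv] := pselect (M v); first by exists 0; rewrite scale0r subr0.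
  pose N : set W := fun z => exists c : K, M (z - c *: v).
  have [] // : N u; last first.
    move=> c Mc; have c0 : c != 0.
      by apply/eqP => c0; apply: Mu; rewrite c0 scale0r subr0 in Mc.
    exists c^-1; have := MZ (- c^-1) _ Mc.
    by rewrite scalerBr scalerA mulNr mulVf // !scaleNr opprK scale1r addrC.
  apply: contrapT => nNu; apply: (Mmax N).
    split=> [x Mx|/(_ v)]; first by exists 0; rewrite scale0r subr0.
    by move=> H; apply: nMv; apply: H; exists 1; rewrite scale1r subrr.
  split=> // c x y [a Ma] [b Mb]; exists (c * a + b).
  rewrite (_ : _ - _ = c *: (x - a *: v) + (y - b *: v)); first exact: Mlin.
  by rewrite scalerDl opprD addrACA scalerBr scalerA.
have [phi phiP] := choice ex.
have uniq v c c' : M (v - c *: u) -> M (v - c' *: u) -> c = c'.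
  move=> Mc Mc'; apply/eqP; rewrite -subr_eq0; apply/negP => /negP cc'.
  apply: Mu; have := MZ (c - c')^-1 _ (MD _ _ (MZ (-1) _ Mc) Mc').
  by rewrite scaleN1r opprB addrA subrK -scalerBl scalerA mulVf ?scale1r.
have phi_lin : linear (phi : W -> K^o).
  move=> c x y; apply: (uniq (c *: x + y)) => //.
  rewrite (_ : _ - _ = c *: (x - phi x *: u) + (y - phi y *: u)); first exact: Mlin.
  by rewrite [X in X *: u]/(_ + _) scalerDl opprD addrACA scalerBr scalerA.
exists (exist _ (phi : W -> K^o) phi_lin); apply: (uniq u) => //.
by rewrite scale1r subrr.
Qed.

(** The pairs in [s] encode the operator of finite rank
[v |-> \sum_(p <- s) p.1 v *: p.2], a projection onto the span of [e]. It plays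
the part of a basis of [W]: tensored with [R], it expresses the elements of
[span e (x) R] by finitely many of their contractions. *)
Lemma finite_rank_projection (e : seq W) : exists s : seq (dual * W),
  (forall p, p \in unzip2 s -> p \in e) /\
  forall v, v \in e -> v = \sum_(p <- s) (sval p.1 v : K) *: p.2.
Proof.
elim: e => [|w e [s [se sP]]]; first by exists [::].
pose P v := \sum_(p <- s) (sval p.1 v : K) *: p.2.
(* Given the projection [P] for [e] and a vector [w] with [P w != w], the new
   projection is [v |-> P v + chi v *: (w - P w)], where [chi] vanishes on [e]
   and is 1 at [w]. Expanding [P w] leaves only second components from [w :: e]. *)
have Plin : linear P.
  move=> c x y; rewrite /P scaler_sumr -big_split; apply: eq_bigr => p _ /=.
  by rewrite (svalP p.1) scalerDl scalerA.
have Pid v : P (P v) = P v.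
  rewrite [LHS](lin_sum _ _ Plin) [RHS]/P !big_seq; apply: eq_bigr => p ps.
  by rewrite (linZ _ _ Plin) {1}/P -sP //; exact/se/map_f.
have [Pw|Pw] := eqVneq (P w) w.
  exists s; split=> [p ps|v]; first by rewrite inE se ?orbT.
  by rewrite inE => /orP[/eqP->|/sP].
have u0 : w - P w != 0 by rewrite subr_eq0 eq_sym.
have [eta etau] := separating_functional u0.
pose chi : W -> K^o := fun v => sval eta (v - P v).
have chi_lin : linear chi.
  move=> c x y; rewrite /chi Plin opprD addrACA -scalerBr; exact: (svalP eta).
have Pe v : v \in e -> P v = v by move=> /sP {2}->.
have chi_e v : v \in e -> chi v = 0.
  by move=> /Pe ve; rewrite /chi ve subrr (lin0 (svalP eta)).
have chi_w : chi w = 1 by [].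
have psi_lin (p : dual * W) :
    linear (fun v => sval p.1 v - chi v * sval p.1 w : K^o).
  move=> c x y; rewrite (svalP p.1) chi_lin /= mulrDl opprD addrACA scalerBr.
  by congr (_ - _ + _); exact/esym/mulrA.
pose psi p : dual := exist _ _ (psi_lin p).
have E v : \sum_(p <- (exist _ chi chi_lin, w) :: [seq (psi p, p.2) | p <- s])
    (sval p.1 v : K) *: p.2 = P v + chi v *: (w - P w).
  rewrite big_cons big_map /=.
  rewrite (eq_bigr _ (fun p _ => scalerBl _ _ _)) sumrB scalerBr addrCA; congr (_ + (_ - _)).
  by rewrite scaler_sumr; apply: eq_bigr => p _; rewrite scalerA.
exists ((exist _ chi chi_lin, w) :: [seq (psi p, p.2) | p <- s]).
split=> [p|v].
  rewrite -[p \in _]/(p \in w :: [seq q.2 | q <- [seq (psi p, p.2) | p <- s]]).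
  rewrite -map_comp (_ : map _ s = unzip2 s) //.
  by rewrite !inE => /orP[->//|/se->]; rewrite orbT.
rewrite E inE => /orP[/eqP->|ve]; last by rewrite chi_e // scale0r addr0 Pe.
by rewrite chi_w scale1r addrC subrK.
Qed.

End LinearFunctionals.

Lemma scale_bilin (K : fieldType) (W R : lmodType K) (phi : W -> K^o) :
  linear phi -> bilin (fun w (r : R) => (phi w : K) *: r).
Proof.
move=> phi_lin; split=> [r|w] c x y /=; first by rewrite phi_lin scalerDl scalerA.
by rewrite scalerDr !scalerA mulrC.
Qed.

Section Contraction.
Variables (K : fieldType) (W : lmodType K).

Definition contr (R : lmodType K) (phi : dual W) : tens W R -> R :=
  tlift (fun w r => (sval phi w : K) *: r).

Lemma contr_linear (R : lmodType K) (phi : dual W) : linear (@contr R phi).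
Proof. exact/tlift_linear/scale_bilin/(svalP phi). Qed.

Lemma contr_pure (R : lmodType K) (phi : dual W) w (r : R) :
  contr phi (tpure w r) = (sval phi w : K) *: r.
Proof. exact/tlift_pure/scale_bilin/(svalP phi). Qed.

(** Membership in the subspace [span e (x) R] of [W (x) R]. *)
Definition tens_in (R : lmodType K) (e : seq W) (t : tens W R) : Prop :=
  exists s : seq (W * R),
    (forall p, p \in s -> p.1 \in e) /\ t = \sum_(p <- s) tpure p.1 p.2.

Lemma tens_in_sub (R : lmodType K) (e e' : seq W) (t : tens W R) :
  {subset e <= e'} -> tens_in e t -> tens_in e' t.
Proof. by move=> ee' [s [se ->]]; exists s; split=> // p /se/ee'. Qed.

Lemma tens_in_repr (R : lmodType K) (t : tens W R) : exists e, tens_in e t.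
Proof.
exists (unzip1 (repr (t : {eq_quot tens_equiv W R}))), (repr (t : {eq_quot tens_equiv W R})).
by split=> [p ps|]; [exact: map_f|exact: tens_sum].
Qed.

Lemma tens_in_tmap (R R' : lmodType K) (u : R -> R') (e : seq W) (t : tens W R) :
  linear u -> tens_in e t -> tens_in e (tmap id u t).
Proof.
move=> ulin [s [se ->]]; exists [seq (p.1, u p.2) | p <- s]; split=> [p|].
  by move=> /mapP[q /se qe ->].
rewrite big_map (lin_sum _ _ (tmap_linear _ ulin)) //; apply: eq_bigr => p _.
by rewrite tmap_pure.
Qed.

Lemma tens_sum_contr (R : lmodType K) (e : seq W) (s : seq (dual W * W)) (t : tens W R) :
  (forall v, v \in e -> v = \sum_(p <- s) (sval p.1 v : K) *: p.2) ->
  tens_in e t -> t = \sum_(p <- s) tpure p.2 (contr p.1 t).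
Proof.
have [tl tr] := tpure_bilin W R.
move=> se [r [re ->]].
under [RHS]eq_bigr => p _.
  rewrite (lin_sum _ _ (contr_linear _)) (lin_sum _ _ (tr _)).
  over.
rewrite exchange_big /= !big_seq; apply: eq_bigr => q /re/se E.
rewrite {1}E (lin_sum _ _ (tl _)); apply: eq_bigr => p _.
by rewrite contr_pure (linZ _ _ (tl _)) (linZ _ _ (tr _)).
Qed.

(** The contractions with the forms of a projection onto a span containing both
tensors are coordinates for them. *)
Lemma contr_separates (R : lmodType K) (t t' : tens W R) :
  (forall phi, contr phi t = contr phi t') -> t = t'.
Proof.
move=> E; have [[e te] [e' te']] := (tens_in_repr t, tens_in_repr t').
have [s [_ sP]] := finite_rank_projection (e ++ e').
rewrite (tens_sum_contr sP (tens_in_sub _ te)); last by move=> v ve; rewrite mem_cat ve.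
rewrite [RHS](tens_sum_contr sP (tens_in_sub _ te')).
  by apply: eq_bigr => p _; rewrite E.
by move=> v ve; rewrite mem_cat ve orbT.
Qed.

Lemma contr_tmap (R R' : lmodType K) (u : R -> R') phi (t : tens W R) :
  linear u -> contr phi (tmap id u t) = u (contr phi t).
Proof.
move=> ulin; rewrite [t]tens_sum; set s := repr _.
rewrite (lin_sum _ _ (tmap_linear _ ulin)) // !(lin_sum _ _ (contr_linear _)).
rewrite (lin_sum _ _ ulin); apply: eq_bigr => p _.
by rewrite tmap_pure // !contr_pure (linZ _ _ ulin).
Qed.

End Contraction.

(** * Commutative algebras presented by their points *)

(** The algebra [presA] is generated by [G], with as relations all the polynomial
identities that hold at every point [rho : G -> R] satisfying [V]. Such points are
therefore jointly faithful on it, so that any identity in it may be checked after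
evaluation; conversely every one of them extends to an algebra morphism. *)
Section Presented.
Variables (K : fieldType) (G : Type).
Variable V : forall R : algcC K, (G -> (sval R : kalg K)) -> Prop.

Inductive term : Type :=
  | TVar of G
  | TOne
  | TLin of K & term & term
  | TMul of term & term.

Fixpoint eval (R : kalg K) (rho : G -> R) (t : term) : R :=
  match t with
  | TVar x => rho x
  | TOne => 1
  | TLin c s t => c *: eval rho s + eval rho t
  | TMul s t => eval rho s * eval rho t
  end.

Definition cterm : Type := {classic term}.

Definition pres_rel (s t : cterm) : bool :=
  `[< forall (R : algcC K) (rho : G -> (sval R : kalg K)),
        V rho -> eval rho s = eval rho t >].

Lemma pres_refl : reflexive pres_rel.
Proof. by move=> s; apply/asboolP. Qed.

Lemma pres_sym : symmetric pres_rel.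
Proof.
by move=> s t; apply/asboolP/asboolP => H R rho Vr; rewrite H.
Qed.

Lemma pres_trans : transitive pres_rel.
Proof.
move=> t s r /asboolP H1 /asboolP H2; apply/asboolP => R rho Vr.
by rewrite H1 // H2.
Qed.

Definition pres_equiv := EquivRel pres_rel pres_refl pres_sym pres_trans.
Definition pres : Type := {eq_quot pres_equiv}.
HB.instance Definition _ := Choice.copy pres {eq_quot pres_equiv}.

Definition pres_of (t : term) : pres := \pi_{eq_quot pres_equiv} (t : cterm).
Definition pres_repr (x : pres) : term := repr (x : {eq_quot pres_equiv}).

Definition pres_eval (R : kalg K) (rho : G -> R) (x : pres) : R :=
  eval rho (pres_repr x).

Lemma pres_evalE (R : algcC K) (rho : G -> (sval R : kalg K)) t :
  V rho -> pres_eval rho (pres_of t) = eval rho t.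
Proof.
move=> Vr; have : pres_rel (pres_repr (pres_of t)) t.
  by apply/(@eqmodP _ pres_equiv); rewrite reprK.
by move=> /asboolP; apply.
Qed.

Lemma pres_eqP (x y : pres) :
  (forall (R : algcC K) (rho : G -> (sval R : kalg K)),
     V rho -> pres_eval rho x = pres_eval rho y) -> x = y.
Proof.
move=> H; rewrite -[x](@reprK _ {eq_quot pres_equiv}).
rewrite -[y](@reprK _ {eq_quot pres_equiv}).
by apply/(@eqmodP _ pres_equiv)/asboolP.
Qed.

Lemma pres_ofK x : pres_of (pres_repr x) = x.
Proof. exact: (@reprK _ {eq_quot pres_equiv}). Qed.

Definition pone := pres_of TOne.
Definition plin c x y := pres_of (TLin c (pres_repr x) (pres_repr y)).
Definition pmul x y := pres_of (TMul (pres_repr x) (pres_repr y)).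
(* Terms have no constructor for zero: it is [(-1) *: 1 + 1]. *)
Definition pzero := plin (-1) pone pone.
Definition padd x y := plin 1 x y.
Definition pscale c x := plin c x pzero.
Definition popp x := pscale (-1) x.

Section Eval.
Variables (R : algcC K) (rho : G -> (sval R : kalg K)).
Hypothesis Vr : V rho.
Lemma pres_eval_one : pres_eval rho pone = 1.
Proof. by rewrite pres_evalE. Qed.
Lemma pres_eval_lin c x y :
  pres_eval rho (plin c x y) = c *: pres_eval rho x + pres_eval rho y.
Proof. by rewrite pres_evalE. Qed.
Lemma pres_eval_mul x y : pres_eval rho (pmul x y) = pres_eval rho x * pres_eval rho y.
Proof. by rewrite pres_evalE. Qed.
Lemma pres_eval_zero : pres_eval rho pzero = 0.
Proof. by rewrite pres_eval_lin pres_eval_one scaleN1r addNr. Qed.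
Lemma pres_eval_add x y : pres_eval rho (padd x y) = pres_eval rho x + pres_eval rho y.
Proof. by rewrite pres_eval_lin scale1r. Qed.
Lemma pres_eval_scale c x : pres_eval rho (pscale c x) = c *: pres_eval rho x.
Proof. by rewrite pres_eval_lin pres_eval_zero addr0. Qed.
Lemma pres_eval_opp x : pres_eval rho (popp x) = - pres_eval rho x.
Proof. by rewrite pres_eval_scale scaleN1r. Qed.
Definition pres_evalM := (pres_eval_one, pres_eval_mul, pres_eval_zero,
  pres_eval_add, pres_eval_scale, pres_eval_opp).
End Eval.

Fact paddA : associative padd.
Proof. by move=> x y z; apply: pres_eqP => R r Vr; rewrite !(pres_evalM Vr) addrA. Qed.
Fact paddC : commutative padd.
Proof. by move=> x y; apply: pres_eqP => R r Vr; rewrite !(pres_evalM Vr) addrC. Qed.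
Fact padd0 : left_id pzero padd.
Proof. by move=> x; apply: pres_eqP => R r Vr; rewrite !(pres_evalM Vr) add0r. Qed.
Fact paddN : left_inverse pzero popp padd.
Proof. by move=> x; apply: pres_eqP => R r Vr; rewrite !(pres_evalM Vr) addNr. Qed.

HB.instance Definition _ := GRing.isZmodule.Build pres paddA paddC padd0 paddN.

Fact pscaleA c d x : pscale c (pscale d x) = pscale (c * d) x.
Proof. by apply: pres_eqP => R r Vr; rewrite !(pres_evalM Vr) scalerA. Qed.
Fact pscale1 : left_id 1 pscale.
Proof. by move=> x; apply: pres_eqP => R r Vr; rewrite !(pres_evalM Vr) scale1r. Qed.
Fact pscaleDr : right_distributive pscale +%R.
Proof. by move=> c x y; apply: pres_eqP => R r Vr; rewrite !(pres_evalM Vr) scalerDr. Qed.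
Fact pscaleDl x : {morph pscale^~ x : c d / c + d >-> c + d}.
Proof. by move=> c d; apply: pres_eqP => R r Vr; rewrite !(pres_evalM Vr) scalerDl. Qed.

HB.instance Definition _ :=
  GRing.Zmodule_isLmodule.Build K pres pscaleA pscale1 pscaleDr pscaleDl.

Fact pmulA : associative pmul.
Proof. by move=> x y z; apply: pres_eqP => R r Vr; rewrite !(pres_evalM Vr) mulrA. Qed.
Fact pmul1l : left_id pone pmul.
Proof. by move=> x; apply: pres_eqP => R r Vr; rewrite !(pres_evalM Vr) mul1r. Qed.
Fact pmul1r : right_id pone pmul.
Proof. by move=> x; apply: pres_eqP => R r Vr; rewrite !(pres_evalM Vr) mulr1. Qed.
Fact pmul_bilin : @bilin K pres pres pres pmul.
Proof.
split=> [z|z] c x y; apply: pres_eqP => R r Vr; rewrite !(pres_evalM Vr).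
- by rewrite mulrDl kscaleAl.
- by rewrite mulrDr kscaleAr.
Qed.

Definition presA : kalg K := KAlg pmulA pmul1l pmul1r pmul_bilin.

Lemma presA_comm : commutativeA presA.
Proof.
move=> x y; apply: pres_eqP => R r Vr.
by rewrite !(pres_eval_mul Vr); exact: (svalP R).
Qed.

Definition presC : algcC K := exist _ presA presA_comm.

Definition pvar (x : G) : presA := pres_of (TVar x).

Lemma pres_ind (P : presA -> Prop) :
  P 1 -> (forall x, P (pvar x)) ->
  (forall (c : K) x y, P x -> P y -> P (c *: x + y)) ->
  (forall x y, P x -> P y -> P (x * y)) -> forall x, P x.
Proof.
move=> P1 PV PL PM x; rewrite -[x]pres_ofK.
elim: (pres_repr x) => {x} [x||c s Ps t Pt|s Ps t Pt]; first exact: PV; first exact: P1.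
- rewrite (_ : pres_of _ = c *: (pres_of s : presA) + (pres_of t : presA)); first exact: PL.
  by apply: pres_eqP => R r Vr; rewrite !(pres_evalM Vr) !pres_evalE.
- rewrite (_ : pres_of _ = (pres_of s : presA) * (pres_of t : presA)); first exact: PM.
  by apply: pres_eqP => R r Vr; rewrite !(pres_evalM Vr) !pres_evalE.
Qed.

Section EvalHom.
Variables (R : algcC K) (rho : G -> (sval R : kalg K)).
Hypothesis Vr : V rho.

Lemma pres_eval_linear : @GRing.linear_for K presA (sval R : kalg K) *:%R (pres_eval rho).
Proof.
move=> c x y; rewrite [LHS](pres_eval_add Vr); congr (_ + _).
exact: pres_eval_scale.
Qed.

Lemma pres_eval_monoid : @GRing.monoid_morphism presA (sval R : kalg K) (pres_eval rho).
Proof. by split=> [|x y]; [exact: pres_eval_one|exact: pres_eval_mul]. Qed.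

Definition pres_hom : algHom presA (sval R) := AlgHom pres_eval_linear pres_eval_monoid.

Lemma pres_hom_var x : pres_hom (pvar x) = rho x.
Proof. exact: pres_evalE. Qed.
End EvalHom.

End Presented.

(** * Families of Hopf algebra morphisms *)

Lemma ah1 (K : fieldType) (A B : kalg K) (f : algHom A B) : f 1 = 1.
Proof. exact: rmorph1. Qed.

Lemma ahM (K : fieldType) (A B : kalg K) (f : algHom A B) x y : f (x * y) = f x * f y.
Proof. exact: rmorphM. Qed.

(** The right-hand side of the equation of a family is [tmerge] after
[(psi (x) psi) Delta]. It is locked so that rewriting with associativity of
composition does not break it up. *)
HB.lock Definition tmerge (K : fieldType) (A B R : kalg K) (cR : commutativeA R) :
    algHom (tensA (tensA A R) (tensA B R)) (tensA (tensA A B) R) :=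
  tmapA (ah_id (tensA A B)) (mu_hom cR) \oA exchA A R B R.

Section Families.
Variable K : fieldType.

Lemma tmerge_pure (A B R : kalg K) (cR : commutativeA R) (a : A) (r : R) (b : B) (s : R) :
  tmerge A B cR (tpure (tpure a r) (tpure b s)) = tpure (tpure a b) (r * s).
Proof.
rewrite tmerge.unlock.
rewrite [LHS](_ : _ = tmapA (ah_id (tensA A B)) (mu_hom cR)
  (exchA A R B R (tpure (tpure a r) (tpure b s)))) //.
by rewrite exchA_pure tmapA_pure mu_hom_pure.
Qed.

Lemma tmerge_natural (A B R A' B' R' : kalg K) (cR : commutativeA R) (cR' : commutativeA R')
    (f : algHom A A') (g : algHom B B') (u : algHom R R') :
  tmerge A' B' cR' \oA tmapA (tmapA f u) (tmapA g u) =
  tmapA (tmapA f g) u \oA tmerge A B cR.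
Proof.
apply: algHom_tens4_ext => a r b s.
rewrite [LHS](_ : _ = tmerge A' B' cR' (tmapA (tmapA f u) (tmapA g u)
  (tpure (tpure a r) (tpure b s)))) //.
rewrite [RHS](_ : _ = tmapA (tmapA f g) u (tmerge A B cR
  (tpure (tpure a r) (tpure b s)))) //.
by rewrite tmerge_pure !tmapA_pure tmerge_pure rmorphM.
Qed.

Lemma tmapA_interchange (A B A' B' : kalg K) (f : algHom A A') (u : algHom B B') :
  tmapA f (ah_id B') \oA tmapA (ah_id A) u = tmapA (ah_id A') u \oA tmapA f (ah_id B).
Proof. by rewrite -!tmapA_comp !ah_comp1l !ah_comp1r. Qed.

Lemma familyE (H1 H2 : hopf K) (R : algcC K) (psi : algHom H1 (tensA H2 (sval R))) :
  family psi <->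
  tmapA (comul H2) (ah_id (sval R : kalg K)) \oA psi =
  tmerge H2 H2 (svalP R) \oA (tmapA psi psi \oA comul H1).
Proof. by rewrite tmerge.unlock ah_compA. Qed.

Lemma family_push (H1 H2 : hopf K) (R R' : algcC K) (u : algHom (sval R) (sval R'))
    (psi : algHom H1 (tensA H2 (sval R))) :
  family psi -> family (R := R') (tmapA (ah_id H2) u \oA psi).
Proof.
move=> /familyE E; apply/familyE.
rewrite tmapA_comp ah_compA tmapA_interchange -ah_compA E !ah_compA; congr (_ \oA _ \oA _).
by rewrite (tmerge_natural (svalP R)) tmapA_id.
Qed.

Lemma family_pull (H1 H1' H2 H2' : hopf K) (R : algcC K) (g : hopfHom H1 H1')
    (f : hopfHom H2' H2) (psi : algHom H1' (tensA H2' (sval R))) :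
  family psi -> family (R := R) (tmapA f (ah_id (sval R : kalg K)) \oA psi \oA g).
Proof.
move=> /familyE E; apply/familyE.
have L : tmapA (comul H2) (ah_id _) \oA tmapA f (ah_id (sval R : kalg K)) =
         tmapA (tmapA f f) (ah_id _) \oA tmapA (comul H2') (ah_id _).
  by rewrite -!tmapA_comp hopfHom_comul.
rewrite !ah_compA L -(ah_compA _ _ psi) E !tmapA_comp -!ah_compA hopfHom_comul.
by rewrite [LHS]ah_compA [RHS]ah_compA (tmerge_natural (svalP R)).
Qed.

End Families.

Lemma contr_tmapA (K : fieldType) (W R R' : kalg K) (u : algHom R R') phi
    (t : tensA W R) :
  contr phi (tmapA (ah_id W) u t) = u (contr phi t).
Proof. exact/contr_tmap/ah_linear. Qed.

Definition generates (K : fieldType) (A : kalg K) (X : Type) (a : X -> A) : Prop :=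
  forall P : A -> Prop,
    P 1 -> (forall x, P (a x)) ->
    (forall (c : K) x y, P x -> P y -> P (c *: x + y)) ->
    (forall x y, P x -> P y -> P (x * y)) -> forall x, P x.

(** * The universal family with values in a given finite-dimensional span *)

Section UniversalFamily.
Variables (K : fieldType) (H1 H2 : hopf K) (X : eqType) (a : X -> H1).
Hypothesis a_gen : generates a.
Variable e : seq H2.

(** Boundedness is only required on the generators [a x]: this is the form in which
it can be achieved for a finitely generated [H1], since the image of all of [H1]
need not lie in [V (x) R] for any finite-dimensional subspace [V] of [H2]. *)
Definition bounded_family (R : algcC K) (psi : algHom H1 (tensA H2 (sval R))) : Prop :=
  family psi /\ forall x, tens_in e (psi (a x)).

Definition coordinates (R : algcC K) (psi : algHom H1 (tensA H2 (sval R)))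
    (p : X * dual H2) : (sval R : kalg K) := contr p.2 (psi (a p.1)).

(** The points at which the universal algebra is to be tested: the tuples of
coordinates of the bounded families. *)
Definition family_point (R : algcC K) (rho : X * dual H2 -> (sval R : kalg K)) : Prop :=
  exists2 psi : algHom H1 (tensA H2 (sval R)), bounded_family psi & rho = coordinates psi.

Let U : algcC K := presC family_point.
Let UA : kalg K := presA family_point.

Section Classify.
Variables (R : algcC K) (psi : algHom H1 (tensA H2 (sval R))).
Hypothesis psib : bounded_family psi.

Lemma coordinates_point : family_point (coordinates psi).
Proof. by exists psi. Qed.

Definition classify : algHom UA (sval R) := pres_hom coordinates_point.

Lemma classify_var p : classify (pvar family_point p) = coordinates psi p.
Proof. exact: pres_hom_var. Qed.
End Classify.

Lemma classify_inj (x y : UA) :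
  (forall R (psi : algHom H1 (tensA H2 (sval R))) (b : bounded_family psi),
     classify b x = classify b y) -> x = y.
Proof.
move=> E; apply: pres_eqP => R rho [psi b ->].
by have := E R psi b; congr (_ = _).
Qed.

Lemma classify_jointly_injective (W : kalg K) (s t : tensA W UA) :
  (forall R (psi : algHom H1 (tensA H2 (sval R))) (b : bounded_family psi),
     tmapA (ah_id W) (classify b) s = tmapA (ah_id W) (classify b) t) -> s = t.
Proof.
move=> E; apply: (@contr_separates K W UA) => phi; apply: classify_inj => R psi b.
by rewrite -!contr_tmapA E.
Qed.

(** The values of the universal family are found on the generators of [H1] and
propagate to all of [H1] because each [psi] is an algebra morphism. *)
Lemma universal_value (z : H1) : exists t : tensA H2 UA,
  forall R (psi : algHom H1 (tensA H2 (sval R))) (b : bounded_family psi),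
    tmapA (ah_id H2) (classify b) t = psi z.
Proof.
move: z; apply: a_gen => [|x|c x y [s Es] [t Et]|x y [s Es] [t Et]].
- by exists 1 => R psi b; rewrite !ah1.
- have [s [_ sP]] := finite_rank_projection e.
  exists (\sum_(p <- s) tpure p.2 (pvar family_point (x, p.1))) => R psi b.
  rewrite [RHS](tens_sum_contr sP (b.2 x)).
  rewrite [LHS](lin_sum _ _ (ah_linear _)); apply: eq_bigr => p _.
  by rewrite tmapA_pure classify_var.
- by exists (c *: s + t) => R psi b; rewrite [LHS]ah_linear [RHS]ah_linear Es Et.
- by exists (s * t) => R psi b; rewrite !ahM Es Et.
Qed.

(** The universal algebra is presented by the coordinates of bounded families.
Since these families are jointly faithful after tensoring with any space, linearity,
multiplicativity and the equation of a family for [h] all follow from the same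
properties of each [psi]. *)
Theorem universal_bounded_family :
  exists (A : algcC K) (h : algHom H1 (tensA H2 (sval A))),
  [/\ bounded_family h,
      forall (R : algcC K) (psi : algHom H1 (tensA H2 (sval R))), bounded_family psi ->
        exists! u : algHom (sval A) (sval R), psi = tmapA (ah_id H2) u \oA h &
      (exists l : seq X, forall x, x \in l) -> fin_gen (sval A)].
Proof.
have [h0 h0P] := choice universal_value.
have h_lin : linear (h0 : H1 -> tensA H2 UA).
  move=> c x y; apply: classify_jointly_injective => R psi b.
  by rewrite [LHS]h0P [RHS]ah_linear !h0P ah_linear.
have h_mon : GRing.monoid_morphism (h0 : H1 -> tensA H2 UA).
  split=> [|x y]; apply: classify_jointly_injective => R psi b.
    by rewrite h0P !ah1.
  by rewrite ahM !h0P ahM.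
pose h : algHom H1 (tensA H2 UA) := AlgHom h_lin h_mon.
have hP R (psi : algHom H1 (tensA H2 (sval R))) (b : bounded_family psi) :
    tmapA (ah_id H2) (classify b) \oA h = psi.
  by apply: algHom_ext => z; exact: h0P.
have var_h p : pvar family_point p = contr p.2 (h (a p.1)).
  apply: classify_inj => R psi b; rewrite classify_var.
  by rewrite -[RHS]contr_tmapA /coordinates -[in LHS](hP _ _ b).
have [s [se sP]] := finite_rank_projection e.
have h_in x : h (a x) = \sum_(p <- s) tpure p.2 (pvar family_point (x, p.1)).
  apply: classify_jointly_injective => R psi b.
  rewrite [LHS]h0P [LHS](tens_sum_contr sP (b.2 x)).
  rewrite [RHS](lin_sum _ _ (ah_linear _)); apply: eq_bigr => p _.
  by rewrite tmapA_pure classify_var.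
exists U, h; split.
- split=> [|x]; last first.
    exists [seq (p.2, pvar family_point (x, p.1)) | p <- s]; split=> [p|].
      by move=> /mapP[q qs ->]; apply/se/map_f.
    by rewrite big_map h_in.
  apply/familyE/algHom_ext => z.
  apply: classify_jointly_injective => R psi b.
  have /familyE Epsi := b.1.
  pose J := tmapA (ah_id (tensA H2 H2)) (classify b).
  have : J \oA (tmapA (comul H2) (ah_id UA) \oA h) =
         J \oA (tmerge H2 H2 (svalP U) \oA (tmapA h h \oA comul H1)).
    have -> : J \oA (tmapA (comul H2) (ah_id UA) \oA h) =
        tmapA (comul H2) (ah_id (sval R : kalg K)) \oA psi.
      by rewrite ah_compA -tmapA_interchange -ah_compA hP.
    have JM : J \oA tmerge H2 H2 (svalP U) = tmerge H2 H2 (svalP R) \oA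
        tmapA (tmapA (ah_id H2) (classify b)) (tmapA (ah_id H2) (classify b)).
      by rewrite (tmerge_natural (svalP U)) tmapA_id.
    rewrite Epsi [RHS]ah_compA JM -[RHS]ah_compA; congr (_ \oA _).
    by rewrite ah_compA -tmapA_comp hP.
  by move=> /(congr1 (fun f : algHom _ _ => f z)).
- move=> R psi b; exists (classify b); split=> [|u Eu]; first by rewrite hP.
  apply: algHom_ext; apply: pres_ind => [|p|c x y Ex Ey|x y Ex Ey].
  + by rewrite !ah1.
  + rewrite classify_var /coordinates Eu.
    by rewrite [LHS]contr_tmapA var_h.
  + by rewrite [LHS]ah_linear [RHS]ah_linear Ex Ey.
  + by rewrite !ahM Ex Ey.
- case=> l lP; pose gens := [seq pvar family_point (x, p.1) | x <- l, p <- s].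
  exists gens => P P1 Pg PL PM.
  (* The forms in [s] suffice: by [h_in], a symbol for any other form [phi] is the
     combination of theirs with coefficients [phi p.2]. *)
  apply: pres_ind => // -[x phi].
  have P0 : P 0 by rewrite -[0](addNr (1 : UA)) -scaleN1r; exact: PL.
  rewrite var_h h_in (lin_sum _ _ (contr_linear _)).
  rewrite big_seq; apply: big_rec => // p y ps Py.
  by rewrite contr_pure; apply: PL => //; apply: Pg; apply: allpairs_f.
Qed.
End UniversalFamily.

(** * Representing a functor of families *)

(** A functor of families covariant in the coefficients [r : E] and contravariant in
[p : P]. The condition [valid] is kept apart from the carrier [fam] so that the
equalities between families are equalities of morphisms. *)
Record familyTheory (P E : category) := FamilyTheory {
  fam :> P -> E -> Type;
  valid : forall p r, fam p r -> Prop;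
  push : forall p r r', hom r r' -> fam p r -> fam p r';
  pull : forall p q r, hom p q -> fam q r -> fam p r;
  push_id : forall p r (u : fam p r), push (idc r) u = u;
  push_comp : forall p r r' r'' (m' : hom r' r'') (m : hom r r') (u : fam p r),
    push (m' \oc m) u = push m' (push m u);
  pull_id : forall p r (u : fam p r), pull (idc p) u = u;
  pull_comp : forall p q q' r (g : hom q q') (f : hom p q) (u : fam q' r),
    pull (g \oc f) u = pull f (pull g u);
  push_pull : forall p q r r' (m : hom r r') (g : hom p q) (u : fam q r),
    push m (pull g u) = pull g (push m u);
  valid_push : forall p r r' (m : hom r r') (u : fam p r), valid u -> valid (push m u);
  valid_pull : forall p q r (g : hom p q) (u : fam q r), valid u -> valid (pull g u) }.

Section Universal.
Variables (P E : category) (F : familyTheory P E).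

Definition universal p a (h : F p a) : Prop :=
  valid h /\ forall r (u : F p r), valid u -> exists! m : hom a r, u = push m h.

Lemma universal_inj p a (h : F p a) r (m m' : hom a r) :
  universal h -> valid (push m h) -> push m h = push m' h -> m = m'.
Proof. by move=> [_ U] v e; have [n [_ nU]] := U _ _ v; rewrite -(nU m) // -(nU m'). Qed.

Variables (a : P -> E) (h : forall p, F p (a p)).
Hypothesis h_univ : forall p, universal (h p).

Lemma universal_functor :
  exists fm : forall p q, hom p q -> hom (a p) (a q),
  [/\ forall p, fm p p (idc p) = idc (a p),
      forall p q r (g : hom q r) (f : hom p q), fm p r (g \oc f) = fm q r g \oc fm p q f &
      forall p q (g : hom p q), push (fm p q g) (h p) = pull g (h q)].
Proof.
have ex p q (g : hom p q) : exists m, push m (h p) = pull g (h q).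
  have [m [-> _]] := (h_univ p).2 _ _ (valid_pull g (h_univ q).1).
  by exists m.
pose fm p q g := sval (cid (ex p q g)).
have fmE p q (g : hom p q) : push (fm p q g) (h p) = pull g (h q) := svalP (cid (ex p q g)).
have fmU p q (g : hom p q) m : push m (h p) = pull g (h q) -> fm p q g = m.
  move=> e; apply: (universal_inj (h_univ p)); rewrite fmE //.
  exact: valid_pull (h_univ q).1.
exists fm; split=> // [p|p q r g f]; apply: fmU; first by rewrite push_id pull_id.
by rewrite push_comp fmE push_pull fmE pull_comp.
Qed.

Variable fm : forall p q, hom p q -> hom (a p) (a q).
Hypothesis fm_natural : forall p q (g : hom p q), push (fm g) (h p) = pull g (h q).
Variables (k : E) (S : P -> Type) (act : forall p q, hom p q -> S q -> S p).
Variable j : forall p, S p -> F p k.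
Hypothesis j_inj : forall p, injective (@j p).
Hypothesis j_valid : forall p (u : F p k), valid u <-> exists s, u = j s.
Hypothesis j_act : forall p q (g : hom p q) s, j (act g s) = pull g (j s).

(** If the families with coefficients [k] are the elements of [S], then the
[k]-points of the representing objects are naturally the elements of [S]; this is
the Yoneda argument evaluated at [k]. *)
Lemma universal_points : exists beta : forall p, S p -> hom (a p) k,
  (forall p, bijective (beta p)) /\
  forall p q (g : hom p q) s, beta p (act g s) = beta q s \oc fm g.
Proof.
have jv p (s : S p) : valid (j s) by apply/j_valid; exists s.
have ex p (s : S p) : exists m, push m (h p) = j s.
  by have [m [-> _]] := (h_univ p).2 _ _ (jv p s); exists m.
pose beta p s := sval (cid (ex p s)).
have betaE p s : push (beta p s) (h p) = j s := svalP (cid (ex p s)).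
have betaU p s m : push m (h p) = j s -> beta p s = m.
  by move=> e; apply: (universal_inj (h_univ p)); rewrite betaE.
exists beta; split=> [p|p q g s]; last first.
  by apply: betaU; rewrite push_comp fm_natural push_pull betaE j_act.
have sur m : exists s, beta p s = m.
  have /j_valid[s e] := valid_push m (h_univ p).1.
  by exists s; apply: betaU.
have [g gP] := choice sur.
exists g => // s; apply: j_inj; rewrite -betaE gP.
exact: betaE.
Qed.
End Universal.

(** * Characters and the counit *)

Section HopfPoints.
Variable K : fieldType.

Section Convolution.
Variables (H : lmodType K) (f g : H -> K^o).
Hypotheses (f_lin : linear f) (g_lin : linear g).

Definition conv (t : tens H H) : K^o :=
  tlift (fun a b : H => (f a : K) * (g b : K) : K^o) t.

Lemma conv_bilin : @bilin K H H K^o (fun a b => (f a : K) * (g b : K)).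
Proof.
split=> [b|a] c x y /=.
- by rewrite f_lin mulrDl; congr (_ + _); exact/esym/mulrA.
- by rewrite g_lin mulrDr; congr (_ + _); exact: mulrCA.
Qed.

Lemma conv_linear : linear conv.
Proof. exact/tlift_linear/conv_bilin. Qed.

Lemma conv_pure a b : conv (tpure a b) = (f a : K) * (g b : K).
Proof. exact/tlift_pure/conv_bilin. Qed.
End Convolution.

(** The characters of a Hopf algebra form a group under convolution, with
[chi \o antipode] the inverse of [chi]; an idempotent of a group is its unit, which
is the counit. *)
Lemma idempotent_character (H : hopf K) (chi : algHom H (kbase K)) :
  (forall x, conv chi chi (comul H x) = chi x) -> forall x, chi x = counit H x.
Proof.
move=> idem x.
have chi_lin : linear (chi : H -> K^o) := ah_linear chi.
pose inv : H -> K^o := fun a => chi (antipode a).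
have inv_lin : linear inv by move=> c y z; rewrite /inv antipode_linear chi_lin.
have convl := conv_linear chi_lin chi_lin.
have iconvl := conv_linear inv_lin chi_lin.
have trip_bilin : @bilin K H (tens H H) K^o
    (fun a t => (inv a : K) * (conv chi chi t : K)).
  split=> [t|a] c y z /=.
  - by rewrite inv_lin mulrDl; congr (_ + _); exact/esym/mulrA.
  - by rewrite convl mulrDr; congr (_ + _); exact: mulrCA.
(* [trip] evaluates the triple convolution [inv * chi * chi]; coassociativity
   equates its two groupings, which are [chi] and [inv * chi]. *)
pose trip := tlift (fun (a : H) t => (inv a : K) * (conv chi chi t : K) : K^o).
have tripl : linear trip := tlift_linear trip_bilin.
have invE y : conv inv chi (comul H y) = counit H y.
  have /(congr1 chi) := antipodel y.
  rewrite (linZ _ _ chi_lin) ah1 [_ *: _]mulr1 => <-.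
  have Sl : linear (tmap (@antipode K H) (id : H -> H)).
    by apply: tmap_linear => //; exact: antipode_linear.
  move: (comul H y); apply: tens_lin_ext => // [c s t|a b].
  - by rewrite Sl mu_linear chi_lin.
  - by rewrite conv_pure // tmap_pure ?mu_pure ?ahM //; exact: antipode_linear.
have right t : trip (tmapA (ah_id H) (comul H) t) = conv inv chi t.
  move: t; apply: tens_lin_ext => [c s t|//|a b]; first by rewrite ah_linear tripl.
  rewrite tmapA_pure /trip tlift_pure; last exact: trip_bilin.
  by rewrite idem conv_pure.
have tassoc_lin : linear (@tassoc K H H H) := tlift_linear (@tassoc_bilin K H H H).
have left1 (t : tens H H) b : trip (tassoc (tpure t b)) = conv inv chi t * (chi b : K).
  have mul_lin : linear (fun c : K^o => (c : K) * (chi b : K) : K^o).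
    by move=> c u v; rewrite mulrDl; congr (_ + _); exact/esym/mulrA.
  have [pl pr] := tpure_bilin (tens H H) H.
  move: t; apply: tens_lin_ext => [c s t|c s t|u v].
  - by rewrite pl tassoc_lin tripl.
  - by rewrite iconvl mul_lin.
  - rewrite tassoc_pure /trip tlift_pure; last exact: trip_bilin.
    by rewrite !conv_pure // mulrA.
have left t : trip (tassoc (tmapA (comul H) (ah_id H) t)) =
    chi (tlift (fun a b : H => (counit H a : K) *: b) t).
  have counit_bilin := scale_bilin H (ah_linear (counit H) : linear (_ : H -> K^o)).
  move: t; apply: tens_lin_ext => [c s t|c s t|a b].
  - by rewrite ah_linear tassoc_lin tripl.
  - by rewrite (tlift_linear counit_bilin) chi_lin.
  - by rewrite tmapA_pure left1 invE tlift_pure // (linZ _ _ chi_lin).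
by rewrite -invE -right -comulA left counitl.
Qed.

(** The pullback of the counit is a character that is idempotent for the
convolution. *)
Lemma comul_counit (H1 H2 : hopf K) (f : algHom H1 H2) :
  tmapA f f \oA comul H1 = comul H2 \oA f -> counit H2 \oA f = counit H1.
Proof.
move=> fD; apply: algHom_ext => x; apply: idempotent_character => {}x.
have el : linear (counit H2 : H2 -> K^o) := ah_linear (counit H2).
have bl := scale_bilin H2 el.
have fl : linear (counit H2 \oA f : H1 -> K^o) := ah_linear (counit H2 \oA f).
rewrite [RHS](_ : _ = counit H2 (f x)) // -[f x in RHS]counitl.
have -> : comul H2 (f x) = tmapA f f (comul H1 x).
  by have := congr1 (fun g : algHom _ _ => g x) fD.
move: (comul H1 x); apply: tens_lin_ext => [c s t|c s t|a b].
- by rewrite (conv_linear fl fl).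
- by rewrite [tmapA f f _]ah_linear (tlift_linear bl) el.
- by rewrite conv_pure // tmapA_pure tlift_pure // (linZ _ _ el).
Qed.
End HopfPoints.

(** * Families over the ground field *)

Section GroundField.
Variable K : fieldType.

Lemma kbase_comm : commutativeA (kbase K).
Proof. exact: mulrC. Qed.

Definition kbaseC : algcC K := exist _ (kbase K) kbase_comm.

Section Unit.
Variable A : kalg K.

Lemma unit_linear : linear (fun a : A => tpure a (1 : kbase K) : tensA A (kbase K)).
Proof. exact: (tpure_bilin _ _).1. Qed.

Lemma unit_monoid :
  GRing.monoid_morphism (fun a : A => tpure a (1 : kbase K) : tensA A (kbase K)).
Proof. by split=> // a b; rewrite tensA_mul_pure mulr1. Qed.

Definition tens_unit : algHom A (tensA A (kbase K)) := AlgHom unit_linear unit_monoid.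

Lemma unscale_bilin : bilin (fun (a : A) (c : kbase K) => (c : K) *: a).
Proof.
split=> [c|a] d x y /=; first by rewrite scalerDr !scalerA mulrC.
by apply: etrans (scalerDl _ _ _) _; congr (_ + _); exact/esym/scalerA.
Qed.

Definition tens_ununit_fun (t : tens A (kbase K)) : A :=
  tlift (fun (a : A) (c : kbase K) => (c : K) *: a) t.

Lemma ununit_linear : linear tens_ununit_fun.
Proof. exact/tlift_linear/unscale_bilin. Qed.

Lemma ununit_pure a c : tens_ununit_fun (tpure a c) = (c : K) *: a.
Proof. exact/tlift_pure/unscale_bilin. Qed.

Lemma ununit_monoid : @GRing.monoid_morphism (tensA A (kbase K)) A tens_ununit_fun.
Proof.
apply: tensA_hom => [||a c b d]; first exact: ununit_linear.
- by rewrite ununit_pure scale1r.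
- by rewrite !ununit_pure -kscaleAl -kscaleAr scalerA.
Qed.

Definition tens_ununit : algHom (tensA A (kbase K)) A :=
  @AlgHom K (tensA A (kbase K)) A _ ununit_linear ununit_monoid.

Lemma tens_unitK : tens_ununit \oA tens_unit = ah_id A.
Proof. by apply: algHom_ext => a; rewrite [LHS]ununit_pure scale1r. Qed.

Lemma tens_ununitK : tens_unit \oA tens_ununit = ah_id (tensA A (kbase K)).
Proof.
apply: algHom_tens_ext => a c; rewrite [LHS](_ : _ = tens_unit (tens_ununit (tpure a c))) //.
rewrite [tens_ununit _]ununit_pure.
rewrite [LHS](linZ _ _ ((tpure_bilin A (kbase K)).1 _)).
rewrite -[LHS](linZ _ _ ((tpure_bilin A (kbase K)).2 _)).
by congr tpure; exact: mulr1.
Qed.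
End Unit.

Lemma tens_unit_natural (A B : kalg K) (f : algHom A B) :
  tmapA f (ah_id (kbase K)) \oA tens_unit A = tens_unit B \oA f.
Proof. by apply: algHom_ext => a; rewrite [LHS]tmapA_pure. Qed.

Lemma tens_unit_inj (A B : kalg K) (f g : algHom A B) :
  tens_unit B \oA f = tens_unit B \oA g -> f = g.
Proof.
by move=> /(congr1 (ah_comp (tens_ununit B))); rewrite !ah_compA tens_unitK !ah_comp1l.
Qed.

(** Under [H2 (x) K = H2] the equation of a family is compatibility with the
comultiplications. *)
Lemma family_kbase (H1 H2 : hopf K) (f : algHom H1 H2) :
  family (R := kbaseC) (tens_unit H2 \oA f) <->
  tmapA f f \oA comul H1 = comul H2 \oA f.
Proof.
have M : tmerge H2 H2 (svalP kbaseC) \oA tmapA (tens_unit H2) (tens_unit H2) =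
    tens_unit (tensA H2 H2).
  apply: algHom_tens_ext => a b.
  rewrite [LHS](_ : _ = tmerge H2 H2 (svalP kbaseC)
    (tmapA (tens_unit H2) (tens_unit H2) (tpure a b))) //.
  by rewrite tmapA_pure tmerge_pure mulr1.
have L : tmapA (comul H2) (ah_id (sval kbaseC : kalg K)) \oA (tens_unit H2 \oA f) =
    tens_unit (tensA H2 H2) \oA (comul H2 \oA f).
  by apply: algHom_ext => x; exact: tmapA_pure.
rewrite familyE L tmapA_comp -(ah_compA (tmapA _ _)) (ah_compA (tmerge _ _ _)) M.
by split=> [/tens_unit_inj->|->].
Qed.

Definition hopf_family (H1 H2 : hopf K) (f : hopfHom H1 H2) :
  algHom H1 (tensA H2 (kbase K)) := tens_unit H2 \oA f.

Lemma hopf_family_inj (H1 H2 : hopf K) : injective (@hopf_family H1 H2).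
Proof. by move=> f g /tens_unit_inj/hopfHom_ext. Qed.

(** A solution of the equation of a family over [K] is a Hopf algebra morphism,
because [comul_counit] supplies compatibility with the counits. *)
Lemma hopf_familyP (H1 H2 : hopf K) (psi : algHom H1 (tensA H2 (kbase K))) :
  family (R := kbaseC) psi <-> exists f : hopfHom H1 H2, psi = hopf_family f.
Proof.
have {1}-> : psi = tens_unit H2 \oA (tens_ununit H2 \oA psi).
  by rewrite ah_compA tens_ununitK ah_comp1l.
split=> [/family_kbase D|[f ->]].
  exists (HopfHom D (comul_counit D)).
  by rewrite /hopf_family /= ah_compA tens_ununitK ah_comp1l.
rewrite [_ \oA (_ \oA hopf_family f)]ah_compA tens_ununitK ah_comp1l.
exact/family_kbase/hopfHom_comul.
Qed.

Lemma hopf_family_pull (H1 H1' H2 H2' : hopf K) (g : hopfHom H1 H1') (f : hopfHom H2' H2)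
    (s : hopfHom H1' H2') :
  hopf_family (hopf_comp (hopf_comp f s) g) =
  tmapA f (ah_id (kbase K)) \oA hopf_family s \oA g.
Proof.
by rewrite /hopf_family /= [tmapA _ _ \oA _]ah_compA tens_unit_natural !ah_compA.
Qed.
End GroundField.

(** * Families into a finite-dimensional Hopf algebra *)

Section FiniteDimensional.
Variable K : fieldType.
Let P : category := prodC (hopfC K) (opC (hopf_fdC K)).

Let fam_fd (p : P) (R : algcC K) : Type := algHom p.1 (tensA (sval p.2 : hopf K) (sval R)).

Definition fd_families : familyTheory P (algcC K).
Proof.
apply: (@FamilyTheory P (algcC K) fam_fd
  (fun p R psi => family psi)
  (fun p R R' u psi => tmapA (ah_id (sval p.2 : hopf K)) u \oA psi)
  (fun p q R g psi => tmapA (g.2 : hopfHom _ _) (ah_id (sval R : kalg K)) \oA psi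
     \oA (g.1 : hopfHom _ _))).
- by move=> p R psi; rewrite tmapA_id ah_comp1l.
- by move=> p R R' R'' m' m psi; rewrite ah_compA -tmapA_comp ah_comp1l.
- by move=> p R psi; rewrite tmapA_id ah_comp1l ah_comp1r.
- move=> p q r R g f psi; rewrite !ah_compA -tmapA_comp ah_comp1l.
  by [].
- move=> p q R R' m g psi; rewrite !ah_compA; congr (_ \oA _ \oA _).
  by rewrite tmapA_interchange.
- by move=> p R R' m psi; exact: family_push.
- by move=> p q R g psi; exact: family_pull.
Defined.

Lemma fin_dim_tens_in (A : kalg K) : fin_dim A ->
  exists e : seq A, forall (R : lmodType K) (t : tens A R), tens_in e t.
Proof.
case=> n [[v2r v2r_lin [r2v v2rK r2vK]]].
have r2v_lin : linear r2v.
  by move=> c x y; rewrite -{1}[x]r2vK -{1}[y]r2vK -v2r_lin v2rK.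
have coord_lin i : linear (fun x => v2r x 0 i : K^o).
  by move=> c x y; rewrite v2r_lin !mxE.
pose s := [seq (exist _ _ (coord_lin i) : dual A, r2v (delta_mx 0 i)) | i <- enum 'I_n].
exists (unzip2 s) => R t; have [e te] := tens_in_repr t.
exists [seq (p.2, contr p.1 t) | p <- s]; split=> [p|].
  by move=> /mapP[q qs ->]; exact: map_f.
rewrite big_map; apply: tens_sum_contr te => v _.
rewrite big_map big_enum -{1}[v]v2rK {1}[v2r v]row_sum_delta (lin_sum _ _ r2v_lin).
by apply: eq_bigr => i _; rewrite (linZ _ _ r2v_lin).
Qed.

(** When [H2] is finite-dimensional, a spanning set [e] bounds every family even
on all of [H1], so that the universal bounded family is the universal family. *)
Lemma fd_universal (p : P) : exists A, exists h : fd_families p A, universal h.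
Proof.
case: p => H1 [H2 fdH2].
have [e eP] := fin_dim_tens_in fdH2.
have gen_id : @generates K H1 H1 id by [].
have [A [h [[hf _] hU _]]] := universal_bounded_family gen_id e.
exists A, h; split=> // R psi psif; apply: hU; split=> // x; exact: eP.
Qed.

Lemma fd_existence :
  exists (A : functor P (algcC K))
         (h : forall (H1 : hopfC K) (H2 : hopf_fdC K),
            algHom H1 (tensA (sval H2) (sval (A (H1, H2))))),
    dagger_fd h.
Proof.
pose A p := sval (cid (fd_universal p)).
pose h p : fd_families p (A p) := sval (cid (svalP (cid (fd_universal p)))).
have hU p : universal (h p) := svalP (cid (svalP (cid (fd_universal p)))).
have [fm [fm1 fmM fmN]] := universal_functor hU.
exists (Functor fm1 fmM), (fun H1 H2 => h (H1, H2)); split.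
- by move=> H1 H2; exact: (hU (H1, H2)).1.
- by move=> H1 H1' H2 H2' g f; exact: (fmN (H1, H2) (H1', H2') (g, f)).
- by move=> H1 H2 R psi; exact: (hU (H1, H2)).2.
Qed.

Lemma fd_natural_points (A : functor P (algcC K))
    (h : forall (H1 : hopfC K) (H2 : hopf_fdC K),
       algHom H1 (tensA (sval H2) (sval (A (H1, H2))))) :
  dagger_fd h -> natural_points (dual_functor A).
Proof.
move=> [hf hN hU].
pose h' (p : P) : fd_families p (A p) :=
  let: (H1, H2) as p := p return fd_families p (A p) in h H1 H2.
have h'U p : universal (h' p).
  by case: p => H1 H2; split; [exact: hf|exact: hU].
have h'N p q g : push (fmap A g) (h' p) = pull g (h' q).
  by case: p q g => H1 H2 [H1' H2'] [g f]; exact: hN.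
have [|||beta [betaB betaN]] := @universal_points _ _ fd_families A h' h'U (@fmap _ _ A) h'N
  (kbaseC K) (fun p => hopfHom p.1 (sval p.2 : hopf K))
  (fun p q g s => hopf_comp (hopf_comp (g.2 : hopfHom _ _) s) (g.1 : hopfHom _ _))
  (fun p => @hopf_family K p.1 (sval p.2)).
- by move=> p; exact: hopf_family_inj.
- by move=> p u; exact: hopf_familyP.
- by move=> p q g s; exact: hopf_family_pull.
exists (fun G2 G1 => beta (G1, G2)); split=> [G2 G1|G2 G2' G1 G1' a b phi].
  exact: betaB.
exact: (betaN (G1', G2') (G1, G2) (b, a) phi).
Qed.
End FiniteDimensional.

(** * Pro-morphisms out of an algebra *)

(** A germ out of a one-element inverse system is a single morphism, so that a
pro-morphism [const_alg H -> Y] is a compatible collection of algebra morphisms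
[H -> Y j]. This turns the equations between pro-morphisms below into equations
between algebra morphisms. *)
Section Levels.
Variable K : fieldType.

Definition const_germ (H B : kalg K) (u : algHom H B) : @germ (algC K) (const_alg H) B :=
  @germ_of (algC K) (const_alg H) B tt u.

Lemma const_germ_inj (H B : kalg K) : injective (@const_germ H B).
Proof.
move=> u v /germ_eqP[k [p [q]]].
by rewrite /= !ah_comp1r.
Qed.

Definition level (H : kalg K) (Y : invsys (algC K)) (psi : proHom (const_alg H) Y)
  (j : idx Y) : algHom H (Y j) := germ_hom (psi j).

Lemma germ_level (H : kalg K) (Y : invsys (algC K)) (psi : proHom (const_alg H) Y) j :
  psi j = const_germ (level psi j).
Proof. by rewrite -[LHS]germ_repr; apply/germ_eqP; exists tt, I, I. Qed.

Lemma level_of (H : kalg K) (Y : invsys (algC K)) (psi : proHom (const_alg H) Y) j u :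
  psi j = const_germ u -> level psi j = u.
Proof. by rewrite germ_level => /const_germ_inj. Qed.

Lemma level_comp (H : kalg K) (Y Z : invsys (algC K)) (g : proHom Y Z)
    (psi : proHom (const_alg H) Y) (i : idx Y) (k : idx Z) (u : algHom (Y i) (Z k)) :
  g k = @germ_of (algC K) Y (Z k) i u -> level (g \oP psi) k = u \oA level psi i.
Proof.
move=> gk; apply: level_of; rewrite /= gk pro_pre_of germ_level.
exact: germ_post_of.
Qed.

Lemma level_tr (H : kalg K) (Y : invsys (algC K)) (psi : proHom (const_alg H) Y) j k
    (p : dle j k) :
  (@tr (algC K) Y j k p : algHom (Y k) (Y j)) \oA level psi k = level psi j.
Proof.
apply/esym/level_of; rewrite -(pro_compat psi p) germ_level.
exact: germ_post_of.
Qed.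

Lemma level_ext (H : kalg K) (Y : invsys (algC K)) (psi psi' : proHom (const_alg H) Y) :
  (forall j, level psi j = level psi' j) -> psi = psi'.
Proof. by move=> e; apply: proHom_ext => j; rewrite !germ_level e. Qed.

Section OfLevels.
Variables (H : kalg K) (Y : invsys (algC K)) (u : forall j, algHom H (Y j)).
Hypothesis u_tr : forall j k (p : dle j k),
  (@tr (algC K) Y j k p : algHom (Y k) (Y j)) \oA u k = u j.

Lemma of_levels_compat j k (p : dle j k) :
  germ_post (tr p) (const_germ (u k)) = const_germ (u j).
Proof. by rewrite -(u_tr p); exact: germ_post_of. Qed.

Definition of_levels : proHom (const_alg H) Y := ProHom of_levels_compat.

Lemma level_of_levels j : level of_levels j = u j.
Proof. exact: level_of. Qed.
End OfLevels.

Lemma level_const_comp (H H' : kalg K) (Y : invsys (algC K)) (g : algHom H H')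
    (psi : proHom (const_alg H') Y) j :
  level (psi \oP const_algHom g) j = level psi j \oA g.
Proof. by rewrite (level_comp _ (germ_level psi j)); congr (_ \oA _); exact: level_of. Qed.

Lemma level_comul (H : hopf K) : level (pro_comul H) (tt, tt) = comul H.
Proof.
rewrite level_const_comp; apply: etrans (ah_comp1l _); congr (_ \oA _).
exact: level_of.
Qed.

Lemma pro_compA (X Y Z T : invsys (algC K)) (h : proHom Z T) (g : proHom Y Z)
  (f : proHom X Y) : h \oP (g \oP f) = h \oP g \oP f.
Proof. exact: (@compcA (proC (algC K))). Qed.

Definition level_alg (R : pro_algcC K) (j : idx (sval R : invsys (algC K))) : algcC K :=
  exist _ (sval R j) (svalP R j).

Lemma tmapP_at (X Y X' Y' : invsys (algC K)) (f : proHom X X') (g : proHom Y Y')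
    (i : idx X') (j : idx Y') (i' : idx X) (j' : idx Y)
    (u : algHom (X i') (X' i)) (v : algHom (Y j') (Y' j)) :
  f i = @germ_of (algC K) X (X' i) i' u -> g j = @germ_of (algC K) Y (Y' j) j' v ->
  tmapP f g (i, j) =
  @germ_of (algC K) (tensP X Y) (tensA (X' i) (Y' j)) (i', j') (tmapA u v).
Proof. by move=> /= -> ->; exact: tens_germ_of. Qed.

Lemma pro_comul_at (H : hopf K) :
  pro_comul H (tt, tt) = @germ_of (algC K) (const_alg H) (tensA H H) tt (comul H).
Proof. by rewrite germ_level level_comul. Qed.

(** Both sides of the equation of a pro-family are pro-morphisms out of
[const_alg H1], and their levels at [((tt, tt), j)] are the two sides of the equation
of a family for [level psi (tt, j)]. *)
Lemma pro_familyP (H1 H2 : hopf K) (R : pro_algcC K)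
    (psi : proHom (const_alg H1) (tensP (const_alg H2) (sval R))) :
  pro_family psi <->
  forall j, family (R := level_alg j) (level psi (tt, j)).
Proof.
have L j : level (tmapP (pro_comul H2) (pro_id (sval R)) \oP psi) ((tt, tt), j) =
    tmapA (comul H2) (ah_id (sval R j : kalg K)) \oA level psi (tt, j).
  exact: (level_comp psi (tmapP_at (pro_comul_at H2) (erefl (pro_id (sval R) j)))).
have M j : level (tmapP (pro_id (tensP (const_alg H2) (const_alg H2))) (muP (svalP R))
    \oP exchP (const_alg H2) (sval R) (const_alg H2) (sval R)
    \oP tmapP psi psi \oP pro_comul H1) ((tt, tt), j) =
    tmapA (ah_id (tensA H2 H2)) (mu_hom (svalP (level_alg j)))
    \oA exchA H2 (sval (level_alg j)) H2 (sval (level_alg j))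
    \oA tmapA (level psi (tt, j)) (level psi (tt, j)) \oA comul H1.
  have at_mu := tmapP_at (erefl (pro_id (tensP (const_alg H2) (const_alg H2)) (tt, tt)))
    (erefl (muP (svalP R) j)).
  have at_exch : exchP (const_alg H2) (sval R) (const_alg H2) (sval R)
      ((tt, tt), (j, j)) = @germ_of (algC K)
        (tensP (tensP (const_alg H2) (sval R)) (tensP (const_alg H2) (sval R)))
        (tensA (tensA H2 H2) (tensA (sval R j) (sval R j))) ((tt, j), (tt, j))
        (exchA H2 (sval R j) H2 (sval R j)) by [].
  have at_psi := tmapP_at (germ_level psi (tt, j)) (germ_level psi (tt, j)).
  rewrite -!pro_compA -!ah_compA.
  pose psi2 := tmapP psi psi \oP pro_comul H1.
  pose psi3 := exchP (const_alg H2) (sval R) (const_alg H2) (sval R) \oP psi2.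
  have E1 := level_comp psi3 at_mu.
  have E2 := level_comp psi2 at_exch.
  have E3 := level_comp (pro_comul H1) at_psi.
  rewrite [LHS]E1 [level psi3 _]E2 [level psi2 _]E3 level_comul.
  (* What remains differs by the proof that [sval R j] is commutative. *)
  by rewrite (Prop_irrelevance (svalP (level_alg j)) (svalP R j)).
split=> [E j|E]; first by rewrite /Defs.family -L -M E.
by apply: level_ext => -[[[] []] j]; rewrite L M; exact: E.
Qed.

Lemma level_push (H1 H2 : kalg K) (R R' : invsys (algC K)) (m : proHom R R')
    (psi : proHom (const_alg H1) (tensP (const_alg H2) R))
    (j : idx R') (i : idx R) (u : algHom (R i) (R' j)) :
  m j = @germ_of (algC K) R (R' j) i u ->
  level (tmapP (pro_id (const_alg H2)) m \oP psi) (tt, j) =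
  tmapA (ah_id H2) u \oA level psi (tt, i).
Proof.
move=> mj; exact: (level_comp psi (tmapP_at (erefl (pro_id (const_alg H2) tt)) mj)).
Qed.

Lemma level_pull (H1 H1' H2 H2' : kalg K) (g : algHom H1 H1') (f : algHom H2' H2)
    (R : invsys (algC K)) (psi : proHom (const_alg H1') (tensP (const_alg H2') R)) j :
  level (tmapP (const_algHom f) (pro_id R) \oP psi \oP const_algHom g) (tt, j) =
  tmapA f (ah_id (R j : kalg K)) \oA level psi (tt, j) \oA g.
Proof.
rewrite level_const_comp; congr (_ \oA _).
exact: (level_comp psi (tmapP_at (erefl (const_algHom f tt)) (erefl (pro_id R j)))).
Qed.
End Levels.

Lemma family_proof_irrelevant (K : fieldType) (H1 H2 : hopf K) (R : algcC K)
    (c : commutativeA (sval R : kalg K)) (psi : algHom H1 (tensA H2 (sval R))) :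
  family psi -> family (R := exist _ (sval R : kalg K) c) psi.
Proof. by case: R c psi => A cA c psi; rewrite (Prop_irrelevance c cA). Qed.

(** * The universal pro-family of a finitely generated Hopf algebra *)

(** The universal families bounded by the finite sequences [e] of vectors of [H2]
form an inverse system: a family bounded by [e] is bounded by every larger [e'],
hence classified by the universal one for [e'], and this classification is the
transition map. *)
Section ProAlgebra.
Variables (K : fieldType) (H1 H2 : hopf K) (X : eqType) (a : X -> H1).
Variables (xs : seq X) (xsP : forall x, x \in xs).
Hypothesis a_gen : generates a.

Definition span_dirset : dirset.
Proof.
exists (seq H2) (fun e e' => {subset e <= e'}).
- by move=> e x.
- by move=> e e' e'' s s' x /s/s'.
- by exists; exact: [::].
- by move=> e e'; exists (e ++ e'); split=> x; rewrite mem_cat => ->; rewrite ?orbT.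
Defined.

Let ex_span_fam (e : seq H2) := universal_bounded_family a_gen e.

Definition span_alg (e : seq H2) : algcC K := sval (cid (ex_span_fam e)).
Definition span_fam (e : seq H2) : algHom H1 (tensA H2 (sval (span_alg e))) :=
  sval (cid (svalP (cid (ex_span_fam e)))).

Let span_famP (e : seq H2) := svalP (cid (svalP (cid (ex_span_fam e)))).

Lemma span_fam_bounded e : bounded_family a e (span_fam e).
Proof. by case: (span_famP e). Qed.

Lemma span_fam_univ e (R : algcC K) (psi : algHom H1 (tensA H2 (sval R))) :
  bounded_family a e psi ->
  exists! u : algHom (sval (span_alg e)) (sval R), psi = tmapA (ah_id H2) u \oA span_fam e.
Proof. by case: (span_famP e) => _ U _; exact: U. Qed.

Lemma span_alg_fin_gen e : fin_gen (sval (span_alg e)).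
Proof. by case: (span_famP e) => _ _; apply; exists xs. Qed.

Lemma bounded_sub e e' (R : algcC K) (psi : algHom H1 (tensA H2 (sval R))) :
  {subset e <= e'} -> bounded_family a e psi -> bounded_family a e' psi.
Proof. by move=> ee' [f b]; split=> // x; exact: tens_in_sub (b x). Qed.

Lemma bounded_push e (R R' : algcC K) (u : algHom (sval R) (sval R'))
    (psi : algHom H1 (tensA H2 (sval R))) :
  bounded_family a e psi -> bounded_family (R := R') a e (tmapA (ah_id H2) u \oA psi).
Proof.
move=> [f b]; split=> [|x]; first exact: family_push.
exact: tens_in_tmap (ah_linear u) (b x).
Qed.

Lemma span_fam_inj e (R : algcC K) (u v : algHom (sval (span_alg e)) (sval R)) :
  tmapA (ah_id H2) u \oA span_fam e = tmapA (ah_id H2) v \oA span_fam e -> u = v.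
Proof.
move=> E; have [w [_ U]] := span_fam_univ (bounded_push u (span_fam_bounded e)).
by rewrite -(U u) // -(U v).
Qed.

Lemma ex_span_tr e e' (p : {subset e <= e'}) :
  exists u : algHom (sval (span_alg e')) (sval (span_alg e)),
    span_fam e = tmapA (ah_id H2) u \oA span_fam e'.
Proof.
by have [u [uE _]] := span_fam_univ (bounded_sub p (span_fam_bounded e)); exists u.
Qed.

Definition span_tr e e' (p : {subset e <= e'}) :
    algHom (sval (span_alg e')) (sval (span_alg e)) :=
  sval (cid (ex_span_tr p)).

Lemma span_trE e e' (p : {subset e <= e'}) :
  tmapA (ah_id H2) (span_tr p) \oA span_fam e' = span_fam e.
Proof. by rewrite -(svalP (cid (ex_span_tr p))). Qed.

Lemma tmapA_idM (A B C D : kalg K) (u : algHom B C) (v : algHom C D) :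
  tmapA (ah_id A) (v \oA u) = tmapA (ah_id A) v \oA tmapA (ah_id A) u.
Proof. by rewrite -tmapA_comp ah_comp1l. Qed.

Definition span_sys : invsys (algC K).
Proof.
apply: (@Invsys (algC K) span_dirset (fun e => sval (span_alg e)) (fun e e' p => span_tr p)).
- by move=> e p; apply: span_fam_inj; rewrite span_trE tmapA_id ah_comp1l.
- move=> e e' e'' p q r; apply: span_fam_inj; rewrite span_trE.
  rewrite [LHS](_ : _ = tmapA (ah_id H2) (span_tr p \oA span_tr q) \oA span_fam e'') //.
  by rewrite tmapA_idM -ah_compA !span_trE.
Defined.

Lemma span_sys_cfg : forall e : idx span_sys, commutativeA (span_sys e) /\ fin_gen (span_sys e).
Proof. by move=> e; split; [exact: svalP (span_alg e)|exact: span_alg_fin_gen]. Qed.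

Definition span_pro : pro_algcfgC K := exist _ span_sys span_sys_cfg.

Definition span_pro_fam : proHom (const_alg H1) (tensP (const_alg H2) span_sys).
Proof.
apply: (@of_levels K H1 (tensP (const_alg H2) span_sys) (fun q => span_fam q.2)) => j k p.
exact: span_trE.
Defined.

Lemma level_span_pro_fam (e : seq H2) :
  @level K H1 (tensP (const_alg H2) span_sys) span_pro_fam (tt, e) = span_fam e.
Proof. exact: level_of_levels. Qed.

Lemma span_pro_fam_family : pro_family (R := cfg_c span_pro) span_pro_fam.
Proof.
apply/pro_familyP => e; rewrite level_span_pro_fam.
exact: family_proof_irrelevant (span_fam_bounded e).1.
Qed.

(** Each component [psi_j] of a pro-family sends the finitely many generators of
[H1] into [span e (x) R_j] for some [e], and is therefore classified by a morphism
out of the algebra of index [e]. Two classifications at different indices agree at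
any index above both, so their germ depends on [psi_j] alone: this gives both the
compatibility in [j] and uniqueness. *)
Lemma span_pro_fam_universal (R : pro_algcC K)
    (psi : proHom (const_alg H1) (tensP (const_alg H2) (sval R))) :
  pro_family psi ->
  exists! m : proHom span_sys (sval R), psi = tmapP (pro_id (const_alg H2)) m \oP span_pro_fam.
Proof.
move=> /pro_familyP psif.
have germ_inj (B : algcC K) e e' (u : algHom (sval (span_alg e)) (sval B))
    (v : algHom (sval (span_alg e')) (sval B)) :
    tmapA (ah_id H2) u \oA span_fam e = tmapA (ah_id H2) v \oA span_fam e' ->
    @germ_of (algC K) span_sys (sval B) e u = @germ_of (algC K) span_sys (sval B) e' v.
  move=> E; have [e'' [p q]] := @d_dir span_dirset e e'.
  apply/germ_eqP; exists e'', p, q; apply: span_fam_inj.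
  by rewrite !tmapA_idM -!ah_compA !span_trE.
have ex j : exists g : @germ (algC K) span_sys (sval R j), exists e,
    exists2 u : algHom (sval (span_alg e)) (sval R j),
      g = @germ_of (algC K) span_sys (sval R j) e u &
      tmapA (ah_id H2) u \oA span_fam e = level psi (tt, j).
  pose t x : tens H2 (sval R j : kalg K) := level psi (tt, j) (a x).
  have [f fP] := choice (fun x => tens_in_repr (t x)).
  have b : bounded_family (R := level_alg j) a (flatten [seq f x | x <- xs]) (level psi (tt, j)).
    split=> [|x]; first exact: psif.
    apply: tens_in_sub (fP x) => v vf.
    by apply/flatten_mapP; exists x.
  have [u [uE _]] := span_fam_univ b.
  by exists (@germ_of (algC K) span_sys (sval R j) _ u), _, u.
have {ex}[g gP] : exists g : forall j, @germ (algC K) span_sys (sval R j), forall j, exists e,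
    exists2 u : algHom (sval (span_alg e)) (sval R j),
      g j = @germ_of (algC K) span_sys (sval R j) e u &
      tmapA (ah_id H2) u \oA span_fam e = level psi (tt, j).
  by exists (fun j => sval (cid (ex j))) => j; exact: svalP (cid (ex j)).
have g_compat j k (p : dle j k) : germ_post (tr p) (g k) = g j.
  have [e [u gk uE]] := gP k; have [e' [v gj vE]] := gP j.
  rewrite gk gj germ_post_of; apply: (germ_inj (level_alg j)).
  have := level_tr psi (conj I p : @dle (idx (tensP (const_alg H2) (sval R))) (tt, j) (tt, k)).
  by rewrite vE => <-; rewrite tmapA_idM -ah_compA uE.
exists (ProHom g_compat); split=> [|m mE].
  apply: level_ext => -[[] j]; have [e [u gj uE]] := gP j.
  rewrite (@level_push K H1 H2 span_sys (sval R) (ProHom g_compat) span_pro_fam j e u gj).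
  by rewrite level_span_pro_fam uE.
apply: proHom_ext => j; have [e [u gj uE]] := gP j.
rewrite [LHS]gj -(germ_repr (m j)); apply: (germ_inj (level_alg j)).
have := @level_push K H1 H2 span_sys (sval R) m span_pro_fam j _ _ (esym (germ_repr (m j))).
by rewrite -mE level_span_pro_fam uE.
Qed.
End ProAlgebra.

(** * Families out of a finitely generated Hopf algebra *)

Section FinitelyGenerated.
Variable K : fieldType.
Let P : category := prodC (hopf_fgC K) (opC (hopfC K)).

Let fam_fg (p : P) (R : pro_algcC K) : Type :=
  proHom (const_alg (sval p.1 : hopf K)) (tensP (const_alg (p.2 : hopf K)) (sval R)).

Definition fg_families : familyTheory P (pro_algcC K).
Proof.
apply: (@FamilyTheory P (pro_algcC K) fam_fg
  (fun p R psi => pro_family psi)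
  (fun p R R' m psi => tmapP (pro_id (const_alg (p.2 : hopf K))) m \oP psi)
  (fun p q R g psi =>
     tmapP (const_algHom (g.2 : hopfHom _ _)) (pro_id (sval R)) \oP psi
       \oP const_algHom (g.1 : hopfHom _ _))).
- move=> p R psi; apply: level_ext => -[[] j].
  by rewrite (level_push _ (erefl (pro_id (sval R) j))) tmapA_id ah_comp1l.
- move=> p R R' R'' m' m psi; apply: level_ext => -[[] j].
  have [i [u e']] : exists i u, m' j = @germ_of (algC K) (sval R') (sval R'' j) i u.
    by eexists; eexists; exact: esym (germ_repr _).
  have [l [v e]] : exists l v, m i = @germ_of (algC K) (sval R) (sval R' i) l v.
    by eexists; eexists; exact: esym (germ_repr _).
  have e'' : (m' \oP m) j = @germ_of (algC K) (sval R) (sval R'' j) l (u \oA v).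
    by rewrite /= e' pro_pre_of e; exact: germ_post_of.
  rewrite (level_push _ e'') (level_push _ e') (level_push _ e).
  by rewrite ah_compA tmapA_idM.
- move=> p R psi; apply: level_ext => -[[] j].
  by rewrite level_pull tmapA_id ah_comp1l; exact: ah_comp1r.
- move=> p q r R g f psi; apply: level_ext => -[[] j].
  rewrite !level_pull !ah_compA -tmapA_comp ah_comp1l.
  by [].
- move=> p q R R' m g psi; apply: level_ext => -[[] j].
  have [i [u e]] : exists i u, m j = @germ_of (algC K) (sval R) (sval R' j) i u.
    by eexists; eexists; exact: esym (germ_repr _).
  rewrite (level_push _ e) !level_pull (level_push _ e).
  by rewrite !ah_compA tmapA_interchange.
- move=> p R R' m psi /pro_familyP f; apply/pro_familyP => j.
  have [i [u e]] : exists i u, m j = @germ_of (algC K) (sval R) (sval R' j) i u.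
    by eexists; eexists; exact: esym (germ_repr _).
  rewrite (level_push _ e); exact: (@family_push K _ _ (level_alg i) (level_alg j) u).
- move=> p q R g psi /pro_familyP f; apply/pro_familyP => j.
  rewrite level_pull; exact: family_pull.
Defined.

Lemma fin_gen_tuple (A : kalg K) : fin_gen A ->
  exists (n : nat) (a : 'I_n -> A), generates a.
Proof.
case=> s sP; exists (size s), (tnth (in_tuple s)) => Q Q1 Qa QL QM.
by apply: sP => // x /(tnthP (in_tuple s))[i ->].
Qed.

Lemma fg_universal (p : P) : exists (A : pro_algcfgC K) (h : fg_families p (cfg_c A)),
  universal h.
Proof.
case: p => [[H1 fgH1] H2]; have [n [a a_gen]] := fin_gen_tuple fgH1.
have xsP (i : 'I_n) : i \in enum 'I_n by rewrite mem_enum.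
exists (span_pro H2 xsP a_gen), (span_pro_fam H2 a_gen); split=> [|R psi].
  exact: span_pro_fam_family.
exact: span_pro_fam_universal.
Qed.

Lemma fg_existence :
  exists (A : functor P (pro_algcfgC K))
         (h : forall (H1 : hopf_fgC K) (H2 : hopfC K),
            proHom (const_alg (sval H1)) (tensP (const_alg H2) (sval (A (H1, H2))))),
    dagger_fg h.
Proof.
pose A p := sval (cid (fg_universal p)).
pose h p : fg_families p (cfg_c (A p)) := sval (cid (svalP (cid (fg_universal p)))).
have hU p : universal (h p) := svalP (cid (svalP (cid (fg_universal p)))).
have [fm [fm1 fmM fmN]] := universal_functor hU.
exists (@Functor P (pro_algcfgC K) A fm fm1 fmM), (fun H1 H2 => h (H1, H2)); split.
- by move=> H1 H2; exact: (hU (H1, H2)).1.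
- by move=> H1 H1' H2 H2' g f; exact: (fmN (H1, H2) (H1', H2') (g, f)).
- by move=> H1 H2 R psi; exact: (hU (H1, H2)).2.
Qed.

Lemma kbase_pro_comm : forall i, commutativeA (const_alg (kbase K) i).
Proof. by move=> i; exact: kbase_comm. Qed.

Definition kbasePC : pro_algcC K := exist _ (const_alg (kbase K)) kbase_pro_comm.

Lemma of_levels_const (H1 H2 : kalg K) (u : algHom H1 (tensA H2 (kbase K))) :
  forall j k (p : @dle (idx (tensP (const_alg H2) (const_alg (kbase K)))) j k),
    (@tr (algC K) (tensP (const_alg H2) (const_alg (kbase K))) j k p : algHom _ _) \oA u = u.
Proof.
move=> j k p; apply: etrans (ah_comp1l _); congr (_ \oA _); exact: tmapA_id.
Qed.

Definition pro_hopf_family (H1 H2 : hopf K) (f : hopfHom H1 H2) :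
    proHom (const_alg H1) (tensP (const_alg H2) (const_alg (kbase K))) :=
  of_levels (of_levels_const (hopf_family f)).

Lemma level_pro_hopf_family (H1 H2 : hopf K) (f : hopfHom H1 H2) j :
  level (pro_hopf_family f) j = hopf_family f.
Proof. exact: level_of_levels. Qed.

Lemma pro_hopf_family_inj (H1 H2 : hopf K) : injective (@pro_hopf_family H1 H2).
Proof.
move=> f g e; apply: hopf_family_inj.
by rewrite -(level_pro_hopf_family f (tt, tt)) e; exact: level_pro_hopf_family.
Qed.

Lemma pro_hopf_familyP (H1 H2 : hopf K)
    (psi : proHom (const_alg H1) (tensP (const_alg H2) (const_alg (kbase K)))) :
  pro_family (R := kbasePC) psi <-> exists f : hopfHom H1 H2, psi = pro_hopf_family f.
Proof.
rewrite pro_familyP; split=> [/(_ tt) F|[f ->] j].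
  have /hopf_familyP[f fE] :=
    @family_proof_irrelevant K H1 H2 (@level_alg K kbasePC tt) (@kbase_comm K) _ F.
  exists f; apply: level_ext => -[[] []].
  by rewrite level_pro_hopf_family -fE.
rewrite level_pro_hopf_family; apply: (@family_proof_irrelevant K H1 H2 (kbaseC K)).
by apply/hopf_familyP; exists f.
Qed.

Lemma pro_hopf_family_pull (H1 H1' H2 H2' : hopf K) (g : hopfHom H1 H1')
    (f : hopfHom H2' H2) (s : hopfHom H1' H2') :
  pro_hopf_family (hopf_comp (hopf_comp f s) g) =
  tmapP (const_algHom f) (pro_id (const_alg (kbase K))) \oP pro_hopf_family s
    \oP const_algHom g.
Proof.
apply: level_ext => -[[] j].
rewrite level_pull !level_pro_hopf_family; exact: hopf_family_pull.
Qed.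

Lemma fg_natural_points (A : functor P (pro_algcfgC K))
    (h : forall (H1 : hopf_fgC K) (H2 : hopfC K),
       proHom (const_alg (sval H1)) (tensP (const_alg H2) (sval (A (H1, H2))))) :
  dagger_fg h -> natural_ind_points (dual_functor A).
Proof.
move=> [hf hN hU].
pose h' (p : P) : fg_families p (cfg_c (A p)) :=
  let: (H1, H2) as p := p return fg_families p (cfg_c (A p)) in h H1 H2.
have h'U p : universal (h' p).
  by case: p => H1 H2; split; [exact: hf|exact: hU].
have h'N (p q : P) (g : hom p q) :
    @push _ _ fg_families p (cfg_c (A p)) (cfg_c (A q)) (fmap A g) (h' p) = pull g (h' q).
  by case: p q g => H1 H2 [H1' H2'] [g f]; exact: hN.
have [|||beta [betaB betaN]] := @universal_points _ _ fg_families (fun p => cfg_c (A p))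
  h' h'U (@fmap _ _ A) h'N
  kbasePC (fun p => hopfHom (sval p.1 : hopf K) (p.2 : hopf K))
  (fun p q g s => hopf_comp (hopf_comp (g.2 : hopfHom _ _) s) (g.1 : hopfHom _ _))
  (fun p => @pro_hopf_family (sval p.1) p.2).
- by move=> p; exact: pro_hopf_family_inj.
- by move=> p u; exact: pro_hopf_familyP.
- by move=> p q g s; exact: pro_hopf_family_pull.
exists (fun G2 G1 => beta (G1, G2)); split=> [G2 G1|G2 G2' G1 G1' a b phi].
  exact: betaB.
exact: (betaN (G1', G2') (G1, G2) (b, a) phi).
Qed.
End FinitelyGenerated.

Theorem corollary5p3 (K : fieldType) :
  ((exists (A : functor (prodC (hopfC K) (opC (hopf_fdC K))) (algcC K))
           (h : forall (H1 : hopfC K) (H2 : hopf_fdC K),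
              algHom H1 (tensA (sval H2) (sval (A (H1, H2))))),
      dagger_fd h) /\
   (forall (A : functor (prodC (hopfC K) (opC (hopf_fdC K))) (algcC K))
           (h : forall (H1 : hopfC K) (H2 : hopf_fdC K),
              algHom H1 (tensA (sval H2) (sval (A (H1, H2))))),
      dagger_fd h -> natural_points (dual_functor A))) /\
  ((exists (A : functor (prodC (hopf_fgC K) (opC (hopfC K))) (pro_algcfgC K))
           (h : forall (H1 : hopf_fgC K) (H2 : hopfC K),
              proHom (const_alg (sval H1)) (tensP (const_alg H2) (sval (A (H1, H2))))),
      dagger_fg h) /\
   (forall (A : functor (prodC (hopf_fgC K) (opC (hopfC K))) (pro_algcfgC K))
           (h : forall (H1 : hopf_fgC K) (H2 : hopfC K),
              proHom (const_alg (sval H1)) (tensP (const_alg H2) (sval (A (H1, H2))))),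
      dagger_fg h -> natural_ind_points (dual_functor A))).
Proof.
split; split.
- exact: fd_existence.
- exact: fd_natural_points.
- exact: fg_existence.
- exact: fg_natural_points.
Qed.
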